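(* Let $\varphi$ be a positive linear map on a finite dimensional $C^*$-algebra $\mathcal{A}$ with $r(\varphi)>0$, and let $\widehat{\varphi}$ be its maximal part. Then $\widehat{\varphi}$ is a non-zero positive map satisfying: (1) $\varphi\widehat{\varphi}=\widehat{\varphi}\varphi=r(\varphi)\widehat{\varphi}$; (2) $\widehat{\varphi}(1)$ is a positive eigenvector of $\varphi$ with eigenvalue $r(\varphi)$; (3) $\widehat{\varphi}^2=\widehat{\varphi}$ if and only if $d_\varphi=1$, and $\widehat{\varphi}^2=0$ if and only if $d_\varphi>1$; (4) if $\widehat{\varphi}^2=\widehat{\varphi}$, then for any $x\in\mathcal{A}$, $\varphi(x)=r(\varphi)x$ if and only if $\widehat{\varphi}(x)=x$.
   Context: $r(\varphi)$ is the spectral radius of $\varphi$. The maximal part is $\widehat{\varphi}=\lim_{N\to\infty}\frac1N\sum_{n=1}^N\varphi^n/\|\varphi^n\|_\beta$, where $\beta$ is a Jordan basis of $\varphi$ (a basis of $\mathcal{A}$ in which the matrix of $\varphi$ is in Jordan form) and $\|\psi\|_\beta$ is the maximum modulus of the entries of the matrix of $\psi$ in the basis $\beta$; this limit exists and does not depend on the choice of Jordan basis. For an eigenvalue $\lambda$, $d_{\varphi,\lambda}$ is the size of the largest Jordan block of $\varphi$ for $\lambda$, and $d_\varphi=\max\{d_{\varphi,\lambda}:|\lambda|=r(\varphi)\}$ (maximal degeneracy index). *)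

(* Defs.v *)
From mathcomp Require Import all_boot all_order all_algebra all_field.
From mathcomp Require Import reals.
From mathcomp.real_closed Require Export complex.
Set Implicit Arguments.
Unset Strict Implicit.
Unset Printing Implicit Defensive.
Import Order.TTheory GRing.Theory Num.Theory.
Local Open Scope ring_scope.

Notation cmod := (@ComplexField.Normc.normc _).

(* Finite dimensional C*-algebras over C = R[i] (R the real numbers).  *)
(* A is a finite dimensional unital C-algebra (falgType); we add an    *)
(* involution and a norm satisfying the C*-axioms.  Completeness is    *)
(* automatic in finite dimension.                                      *)
Record cstar_alg (R : realType) (A : falgType R[i]) := CStarAlg {
  cstar : A -> A;
  cnorm : A -> R;
  cstarD : forall x y, cstar (x + y) = cstar x + cstar y;
  cstarZ : forall (a : R[i]) x, cstar (a *: x) = a^* *: cstar x;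
  cstarM : forall x y, cstar (x * y) = cstar y * cstar x;
  cstarK : forall x, cstar (cstar x) = x;
  cnorm_ge0 : forall x, 0 <= cnorm x;
  cnorm_eq0 : forall x, cnorm x = 0 -> x = 0;
  cnormD : forall x y, cnorm (x + y) <= cnorm x + cnorm y;
  cnormZ : forall (a : R[i]) x, cnorm (a *: x) = cmod a * cnorm x;
  cnormM : forall x y, cnorm (x * y) <= cnorm x * cnorm y;
  cnorm_cstar : forall x, cnorm (cstar x * x) = cnorm x ^+ 2
}.

Section Defs.
Variables (R : realType) (A : falgType R[i]).
Local Notation n := (\dim {:A}).

Definition is_pos (S : cstar_alg A) (x : A) := exists y : A, x = cstar S y * y.

Definition positive_map (S : cstar_alg A) (phi : 'End(A)) :=
  forall x, is_pos S x -> is_pos S (phi x).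

Definition spectral_radius (phi : 'End(A)) (r : R) :=
  (exists2 l : R[i], passmx.leigenvalue phi l & cmod l = r) /\
  (forall l : R[i], passmx.leigenvalue phi l -> cmod l <= r).

Definition lpow (phi : 'End(A)) (k : nat) : 'End(A) :=
  iter k (fun g => (phi \o g)%VF) \1%VF.

(* matrix of psi in the basis b, usual (column) convention:
   column j holds the coordinates of psi (b_j). *)
Definition matof (b : n.-tuple A) (psi : 'End(A)) : 'M[R[i]]_n :=
  (passmx.mxof b b psi)^T.

Definition mxe (M : 'M[R[i]]_n) (i j : nat) : R[i] :=
  match @insub _ (fun k => k < n)%N _ i, @insub _ (fun k => k < n)%N _ j with
  | Some i', Some j' => M i' j'
  | _, _ => 0
  end.

Definition is_jordan (M : 'M[R[i]]_n) :=
  (forall i j : nat, j <> i -> j <> i.+1 -> mxe M i j = 0) /\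
  (forall i : nat, mxe M i i.+1 = 0 \/
                   (mxe M i i.+1 = 1 /\ mxe M i i = mxe M i.+1 i.+1)).

Definition jordan_basis (phi : 'End(A)) (b : n.-tuple A) :=
  basis_of fullv b /\ is_jordan (matof b phi).

Definition bnorm (b : n.-tuple A) (psi : 'End(A)) : R :=
  \big[Num.max/0]_(i < n) \big[Num.max/0]_(j < n) cmod (matof b psi i j).

Definition cesaro (phi : 'End(A)) (b : n.-tuple A) (N : nat) : 'End(A) :=
  N%:R^-1 *: \sum_(1 <= k < N.+1) ((bnorm b (lpow phi k))^-1)%:C%C *: lpow phi k.

Definition maximal_part (phi : 'End(A)) (b : n.-tuple A) (psi : 'End(A)) :=
  forall eps : R, 0 < eps -> exists N0 : nat, forall N : nat, (N0 <= N)%N ->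
    forall i j : 'I_n, cmod (matof b (cesaro phi b N - psi) i j) < eps.

Definition jchain (M : 'M[R[i]]_n) (l : R[i]) (i m : nat) : bool :=
  [&& (i + m <= n)%N, mxe M i i == l &
      [forall t : 'I_n, (t.+1 < m)%N ==> (mxe M (i + t) (i + t).+1 == 1)]].

(* d_{phi,l}: size of the largest Jordan block for l (M a Jordan matrix) *)
Definition dlam (M : 'M[R[i]]_n) (l : R[i]) : nat :=
  \max_(i < n) \max_(m < n.+1 | jchain M l i m) m.

Definition dphi (M : 'M[R[i]]_n) (r : R) : nat :=
  \max_(i < n | cmod (M i i) == r) dlam M (M i i).

End Defs.

(* Main.v *)
(* With [tau x] the trace of left multiplication by [x], [tau (y^* y) > 0] for [y <> 0], so an
   element [x] is positive iff [tau (v^* x v) >= 0] for all [v]; hence positivity is preserved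
   by limits, and every matrix entry of a positive map [f] is bounded by a constant times
   [tau (f 1)].  In a Jordan basis the powers of [phi], divided by their norms, have entries
   which either tend to [0] or are asymptotic to powers of [l / r], where [l] is the eigenvalue
   of a Jordan block of maximal size with [|l| = r]; in the mean only [l = r] survives.  Hence
   the maximal part has an explicit matrix, supported on the corners of the blocks of size
   [d_phi] for the eigenvalue [r], from which the algebraic identities are read off.  It is
   non-zero because the normalised powers stay bounded away from [0] at [1]. *)
Require Import Defs.
From HB Require Import structures.
From mathcomp Require Import all_boot all_order all_algebra all_field.
From mathcomp Require Import reals.
From mathcomp Require Import ring.
From mathcomp.real_closed Require Import complex.
Set Implicit Arguments.
Unset Strict Implicit.
Unset Printing Implicit Defensive.
Import Order.TTheory GRing.Theory Num.Theory.
Local Open Scope ring_scope.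

(** * Spectral theory in a finite dimensional C*-algebra *)

(** In the rank factorisation of [E], both factors can be cancelled from [E *m E = E]. This makes
    [row_base E *m col_base E] the identity of size [\rank E], and cyclicity of the trace
    concludes. *)
Lemma mxtrace_idempotent (F : fieldType) (n : nat) (E : 'M[F]_n) :
  E *m E = E -> \tr E = (\rank E)%:R.
Proof.
move=> EE.
have h : row_base E *m col_base E = 1%:M.
  apply: (row_free_inj (row_base_free E)); apply: (row_full_inj (col_base_full E)).
  have -> : col_base E *m (row_base E *m col_base E *m row_base E) =
            (col_base E *m row_base E) *m (col_base E *m row_base E) by rewrite !mulmxA.
  by rewrite mulmx_base EE mul1mx mulmx_base.
by rewrite -{1}(mulmx_base E) mxtrace_mulC h mxtrace1.
Qed.

Section SpectralTheory.
Variables (R : realType) (A : falgType R[i]) (S : cstar_alg A).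
Local Notation C := R[i].
Local Notation star := (cstar S).

(** The norm enters the later positivity arguments through this consequence of the C*-identity. *)
Lemma star_proper x : star x * x = 0 -> x = 0.
Proof.
move=> h; apply: (cnorm_eq0 (c := S)); apply/eqP; rewrite -sqrf_eq0 -cnorm_cstar h.
by have := cnormZ S 0 0; rewrite scale0r Normc.normc0 mul0r => ->.
Qed.

Lemma star0 : star 0 = 0.
Proof. by have := cstarZ S 0 0; rewrite scale0r conjC0 scale0r. Qed.

Lemma star1 : star 1 = 1.
Proof. by rewrite -[LHS]mulr1 -[1 in X in _ * X](cstarK S) -cstarM mulr1 cstarK. Qed.

Lemma starN x : star (- x) = - star x.
Proof. by rewrite -scaleN1r cstarZ rmorphN rmorph1 scaleN1r. Qed.

Lemma starB x y : star (x - y) = star x - star y.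
Proof. by rewrite cstarD starN. Qed.

Lemma star_sum I (r : seq I) (P : pred I) (F : I -> A) :
  star (\sum_(i <- r | P i) F i) = \sum_(i <- r | P i) star (F i).
Proof. exact: (big_morph _ (cstarD S) star0). Qed.

Lemma eigenvalue_real a u (z : C) :
  star a = a -> a * u = z *: u -> u != 0 -> z^* = z.
Proof.
move=> sa au u0; apply/eqP; rewrite -subr_eq0.
have : (z^* - z) *: (star u * u) = 0.
  rewrite scalerBl [X in _ - X]scalerAr -au mulrA.
  by rewrite -{1}sa -cstarM au cstarZ scalerAl subrr.
move/eqP; rewrite scaler_eq0 => /orP[//|/eqP /star_proper u00].
by rewrite u00 eqxx in u0.
Qed.

(** The [\dim {:A} + 1] powers of [a] from exponent 0 on are linearly dependent. The resulting
    nonzero polynomial splits over the complex numbers. *)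
Lemma annihilating_roots (a : A) :
  exists s : seq C, \prod_(z <- s) (a - z%:A) = 0.
Proof.
pose X := [tuple a ^+ i | i < (\dim {:A}).+1].
have: ~~ free X.
  apply/negP => /eqP h; have := dimvS (subvf <<X>>%VS).
  by rewrite h size_tuple ltnn.
move/freeP => h.
have [k [sk [i ki]]] : exists k : 'I_(\dim {:A}).+1 -> C,
  \sum_(i < (\dim {:A}).+1) k i *: a ^+ i = 0 /\ exists i, k i != 0.
  apply: boolp.contrapT => H; apply: h => k sk i; apply: boolp.contrapT => /eqP ki.
  apply: H; exists k; split; last by exists i.
  by rewrite -[RHS]sk; apply: eq_bigr => j _; rewrite -tnth_nth tnth_mktuple.
pose p := \poly_(j < (\dim {:A}).+1) k (inord j).
have p0 : p != 0.
  apply/eqP => p0; case/eqP: ki.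
  by have := coef_poly (\dim {:A}).+1 (fun j => k (inord j)) i;
    rewrite -/p p0 coef0 ltn_ord inord_val => <-.
have pa : horner_alg a p = 0.
  rewrite /p poly_def linear_sum /= -[RHS]sk; apply: eq_bigr => j _.
  by rewrite inord_val linearZ /= mulr_algl rmorphXn /= horner_algX.
have [s ps] := closed_field_poly_normal p.
exists s; move: pa; rewrite ps linearZ /= mulr_algl rmorph_prod /= => /eqP.
rewrite scaler_eq0 lead_coef_eq0 (negPf p0) /= => /eqP <-.
by apply: eq_bigr => z _; rewrite rmorphB /= horner_algX horner_algC.
Qed.

(** Induction on the list of roots, applied to [(a - z%:A) * y]. Roots may repeat: a self-adjoint
    element has no generalised eigenvectors beyond the true ones, because the involution is
    proper. *)
Lemma eigenvector_decomposition a (s : seq C) y :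
  star a = a -> a * y = y * a -> \prod_(z <- s) (a - z%:A) * y = 0 ->
  exists (t : seq C) (e : C -> A),
    [/\ uniq t, y = \sum_(z <- t) e z,
        forall z, z \in t -> e z != 0 /\ a * e z = z *: e z
      & forall z, a * e z = e z * a].
Proof.
move=> sa; elim/last_ind: s y => [|s z IH] y ay.
  rewrite big_nil mul1r => ->; exists [::], (fun=> 0).
  by split=> // [|z]; rewrite ?big_nil ?mulr0 ?mul0r.
have ayz : a * ((a - z%:A) * y) = (a - z%:A) * y * a.
  by rewrite -mulrA -ay !mulrA mulrBl mulrBr -scalerAl -scalerAr mul1r mulr1.
rewrite big_rcons /= -mulrA => h.
have {IH} [t [e [ut yt te ce]]] := IH _ ayz h.
(* On the component for [w != z], [a - z] acts as the nonzero scalar [w - z], so that component of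
   [(a - z) * y] can be divided back and removed from [y]. *)
pose y' := y - \sum_(w <- t | w != z) (w - z)^-1 *: e w.
have ay' : a * y' = y' * a.
  rewrite mulrBr mulrBl ay mulr_sumr mulr_suml; congr (_ - _).
  by apply: eq_bigr => w _; rewrite -scalerAr -scalerAl ce.
have azy' : (a - z%:A) * y' = \sum_(w <- t | w == z) e w.
  rewrite mulrBr yt (bigID (fun w => w == z)) /= -[RHS]addr0 -addrA; congr (_ + _).
  rewrite mulr_sumr -sumrB big_seq_cond big1 // => w /andP[wt wz].
  rewrite mulrBl -!scalerAr -scalerAl mul1r (te _ wt).2 -scalerBr -scalerBl scalerA.
  by rewrite mulVf ?scale1r ?subrr // subr_eq0.
(* Otherwise [e z = (a - z) * y'], so [star (e z) * e z = star y' * (a - z) * e z = 0], which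
   properness forbids. *)
have zt : z \notin t.
  apply/negP => zt; have [ez0 aez] := te _ zt.
  have zr := eigenvalue_real sa aez ez0.
  move: azy'; rewrite -big_filter filter_pred1_uniq // big_seq1 => azy'.
  case/eqP: ez0; apply: star_proper; rewrite -{1}azy' cstarM (starB a) sa cstarZ zr star1.
  by rewrite -mulrA mulrBl aez -scalerAl mul1r subrr mulr0.
move: azy'; rewrite big1_seq; last first.
  by move=> w /andP[/eqP-> wt]; rewrite wt in zt.
move=> /eqP; rewrite mulrBl -scalerAl mul1r subr_eq0 => /eqP ay'z.
have yE : y = y' + \sum_(w <- t) (w - z)^-1 *: e w.
  rewrite /y' -addrA addrC; apply/eqP; rewrite eq_sym -subr_eq0 addrK addrC.
  rewrite subr_eq0; apply/eqP; rewrite big_seq [RHS]big_seq_cond.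
  rewrite [RHS]big_seq_cond; apply: eq_bigl => w.
  by case: (boolP (w \in t)) => //= wt; case: eqP => // wz; rewrite -wz wt in zt.
pose e' w := if w == z then y' else (w - z)^-1 *: e w.
have te' w : w \in t -> [/\ e' w = (w - z)^-1 *: e w, e' w != 0 & a * e' w = w *: e' w].
  move=> wt; have [ew aw] := te _ wt.
  have wz : w != z by apply: contraNneq zt => <-.
  rewrite /e' (negPf wz) -scalerAr aw; split => //; last by rewrite !scalerA mulrC.
  by rewrite scaler_eq0 invr_eq0 subr_eq0 (negPf wz).
have et : \sum_(w <- t) e' w = \sum_(w <- t) (w - z)^-1 *: e w.
  by apply: eq_big_seq => w /te'[].
have ce' w : a * e' w = e' w * a.
  by rewrite /e'; case: eqP => // _; rewrite -scalerAl -scalerAr ce.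
have e'z : e' z = y' by rewrite /e' eqxx.
(* All listed components must be nonzero, so [z] joins the list only if [y'] does not vanish. *)
have [y'0|y'0] := eqVneq y' 0.
  by exists t, e'; rewrite et {1}yE y'0 add0r; split=> // w /te'[].
exists (z :: t), e'; rewrite /= zt ut big_cons et e'z; split=> // w.
by rewrite inE => /orP[/eqP->|/te'[]//]; rewrite e'z.
Qed.

Definition is_proj p := star p = p /\ p * p = p.

Definition spectral_family (t : seq C) (e : C -> A) :=
  [/\ uniq t, 1 = \sum_(z <- t) e z,
      forall z, z \in t -> [/\ e z != 0, z \is Num.real & is_proj (e z)]
    & {in t &, forall z w, z != w -> e z * e w = 0}].

(** The spectral projections are the eigencomponents of [1]. *)
Lemma spectral_theorem a : star a = a ->
  exists (t : seq C) (e : C -> A),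
    spectral_family t e /\ a = \sum_(z <- t) z *: e z.
Proof.
move=> sa; have [s as0] := annihilating_roots a.
have [||t [e [ut e1 te ce]]] := @eigenvector_decomposition a s 1 sa.
- by rewrite mul1r mulr1.
- by rewrite mulr1.
have zr z : z \in t -> z^* = z.
  by move=> /te[e0 ae]; exact: eigenvalue_real sa ae e0.
have orth u v z w : z != w -> u * a = z *: u -> a * v = w *: v -> u * v = 0.
  move=> zw ua av; apply/eqP; have : (z - w) *: (u * v) = 0.
    by rewrite scalerBl scalerAl -ua -mulrA av -scalerAr subrr.
  by move/eqP; rewrite scaler_eq0 subr_eq0 (negPf zw).
have ea z : z \in t -> e z * a = z *: e z by move=> /te[_ <-]; rewrite ce.
have ase z : z \in t -> a * star (e z) = z *: star (e z).
  by move=> zt; rewrite -{1}sa -cstarM ea // cstarZ zr.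
(* Multiply [star (e z)] by [1 = \sum e w]: the terms with [w != z] vanish by orthogonality. The
   right-hand side is self-adjoint, so [e z] is self-adjoint and then idempotent. *)
have see z : z \in t -> star (e z) = e z * star (e z).
  move=> zt; rewrite -[LHS]mul1r e1 mulr_suml (bigD1_seq z) //=.
  rewrite big_seq_cond big1 ?addr0 // => w /andP[wt wz].
  exact: orth wz (ea _ wt) (ase _ zt).
have ese z : z \in t -> star (e z) = e z.
  by move=> zt; rewrite [LHS]see // -[RHS](cstarK S) [in RHS](see z zt) cstarM cstarK.
exists t, e; split; last first.
  by rewrite -[LHS]mulr1 e1 mulr_sumr; apply: eq_big_seq => z /te[].
split => //.
- move=> z zt; have [e0 ae] := te _ zt; split => //.
    by apply/CrealP; exact: zr.
  by split; [exact: ese | rewrite -{2}(ese z zt) -see // ese].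
- by move=> z w zt wt zw; exact: orth zw (ea _ zt) (te _ wt).2.
Qed.

Lemma mulr_spectral t e (c d : C -> C) : spectral_family t e ->
  (\sum_(z <- t) c z *: e z) * (\sum_(z <- t) d z *: e z) =
  \sum_(z <- t) (c z * d z) *: e z.
Proof.
move=> [ut _ te orth]; rewrite mulr_suml; apply: eq_big_seq => z zt.
rewrite mulr_sumr (bigD1_seq z) //= big_seq_cond big1 => [|w /andP[wt wz]].
  have [_ _ [_ ee]] := te _ zt.
  by rewrite addr0 -scalerAl -scalerAr ee scalerA.
by rewrite -scalerAl -scalerAr orth ?scaler0 // eq_sym.
Qed.

Lemma cartesian_decomposition x :
  exists a k, [/\ star a = a, star k = k & x = a + 'i *: k].
Proof.
exists (2^-1 *: (x + star x)), ((2 * 'i)^-1 *: (x - star x)); split.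
- by rewrite cstarZ cstarD cstarK fmorphV rmorph_nat addrC.
- rewrite cstarZ starB cstarK fmorphV rmorphM /= rmorph_nat conjCi.
  by rewrite mulrN invrN scaleNr -scalerN opprB.
- rewrite scalerA invfM mulrCA divff ?neq0Ci // mulr1 -scalerDr addrACA subrr addr0.
  by rewrite -mulr2n -[x *+ 2]scaler_nat scalerA mulVf ?scale1r // pnatr_eq0.
Qed.

(** By the Cartesian decomposition and the spectral theorem, projections span the algebra, so linear
    statements need checking on projections only. *)
Lemma proj_span_ind (P : A -> Prop) :
  P 0 -> (forall x y, P x -> P y -> P (x + y)) ->
  (forall (c : C) x, P x -> P (c *: x)) -> (forall p, is_proj p -> P p) ->
  forall x, P x.
Proof.
move=> P0 PD PZ Pp x; have [a [k [sa sk ->]]] := cartesian_decomposition x.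
have Psa b : star b = b -> P b.
  move=> /spectral_theorem[t [e [[_ _ te _] ->]]]; rewrite big_seq.
  by elim/big_ind: _ => // z /te[_ _ /Pp]; exact: PZ.
by apply: PD; [|apply: PZ]; exact: Psa.
Qed.

End SpectralTheory.

(** * The trace form and the positive cone *)

Section Trace.
Variables (R : realType) (A : falgType R[i]) (S : cstar_alg A).
Local Notation C := R[i].
Local Notation star := (cstar S).

Definition tau (x : A) : C :=
  \tr (passmx.mxof (vbasis {:A}) (vbasis {:A}) (amull x)).

Lemma tau_is_linear : linear_for *%R tau.
Proof. by move=> c x y; rewrite /tau [amull _]linearP /= passmx.mxof_linear linearP. Qed.

HB.instance Definition _ := GRing.isLinear.Build C A C *%R tau tau_is_linear.

Lemma tauD x y : tau (x + y) = tau x + tau y. Proof. exact: linearD. Qed.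

Lemma tauB x y : tau (x - y) = tau x - tau y. Proof. exact: linearB. Qed.

Lemma tauZ c x : tau (c *: x) = c * tau x. Proof. exact: linearZ. Qed.

Lemma tauC x y : tau (x * y) = tau (y * x).
Proof.
have amull_comp u v : amull (u * v) = (amull u \o amull v)%VF :> 'End(A).
  by apply/lfunP => w; rewrite comp_lfunE !lfunE /= mulrA.
rewrite /tau !amull_comp !(passmx.mxof_comp _ _ (vbasisP _)).
exact: mxtrace_mulC.
Qed.

(** Left multiplication by [p] is a nonzero idempotent, so its trace is its positive rank. *)
Lemma tau_proj_gt0 p : p * p = p -> p != 0 -> 0 < tau p.
Proof.
move=> pp p0; rewrite /tau mxtrace_idempotent; last first.
  rewrite -(passmx.mxof_comp _ _ (vbasisP _)); congr passmx.mxof.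
  by apply/lfunP => w; rewrite comp_lfunE !lfunE /= mulrA pp.
rewrite ltr0n lt0n mxrank_eq0 passmx.mxof_eq0 ?vbasisP //.
by apply: contra p0 => /eqP/lfunP/(_ 1); rewrite !lfunE /= mulr1 => ->.
Qed.

Lemma tau_lincomb (t : seq C) (e : C -> A) (c : C -> C) :
  tau (\sum_(z <- t) c z *: e z) = \sum_(z <- t) c z * tau (e z).
Proof. by rewrite linear_sum; apply: eq_bigr => z _; rewrite linearZ. Qed.

Lemma spectral_tau_gt0 t e z : spectral_family S t e -> z \in t -> 0 < tau (e z).
Proof. by move=> [_ _ te _] /te[e0 _ [_]] /tau_proj_gt0; apply. Qed.

Lemma tau_sqr_ge0 a : star a = a -> 0 <= tau (a * a) /\ (tau (a * a) = 0 -> a = 0).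
Proof.
move=> /spectral_theorem[t [e [te ->]]].
rewrite (mulr_spectral _ _ te) (tau_lincomb t e (fun z => z * z)).
have ge0 z : z \in t -> 0 <= z * z * tau (e z).
  move=> zt; have [_ _ /(_ _ zt)[_ zr _] _] := te.
  by rewrite mulr_ge0 ?(ltW (spectral_tau_gt0 te zt)) // -expr2 real_exprn_even_ge0.
split; first by rewrite big_seq sumr_ge0.
rewrite big_seq => /eqP; rewrite psumr_eq0 // => /allP h.
rewrite big_seq big1 // => z zt; have := h _ zt.
rewrite zt !mulf_eq0 orbb (gt_eqF (spectral_tau_gt0 te zt)) orbF.
by move=> /eqP->; rewrite scale0r.
Qed.

Lemma tau_real a : star a = a -> tau a \is Num.real.
Proof.
move=> /spectral_theorem[t [e [te ->]]].
rewrite (tau_lincomb t e id) big_seq rpred_sum // => z zt.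
have [_ _ /(_ _ zt)[_ zr _] _] := te.
by rewrite rpredM // gtr0_real // (spectral_tau_gt0 te zt).
Qed.

(* [tau (y^* y) = tau (y y^* )], and [y^* y + y y^* = 2 (a^2 + k^2)] for [y = a + i k]. *)
Lemma tau_star_mul_ge0 y :
  0 <= tau (star y * y) /\ (tau (star y * y) = 0 -> y = 0).
Proof.
have [a [k [sa sk ->]]] := cartesian_decomposition S y.
have -> : tau (star (a + 'i *: k) * (a + 'i *: k)) = tau (a * a) + tau (k * k).
  have sy : star (a + 'i *: k) = a - 'i *: k.
    by rewrite cstarD cstarZ sa sk conjCi scaleNr.
  have ii : 'i * 'i = -1 :> C by rewrite -expr2 sqrCi.
  have -> : star (a + 'i *: k) * (a + 'i *: k) =
            a * a + k * k + 'i *: (a * k - k * a).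
    rewrite sy mulrBl !mulrDr -!scalerAl -!scalerAr scalerA ii scaleN1r opprD opprK.
    by rewrite [- _ + _]addrC addrACA -scalerBr.
  by rewrite !tauD tauZ tauB (tauC k a) subrr mulr0 addr0.
have [a0 a00] := tau_sqr_ge0 sa; have [k0 k00] := tau_sqr_ge0 sk.
split; first exact: addr_ge0.
by move=> /eqP; rewrite paddr_eq0 // => /andP[/eqP/a00-> /eqP/k00->]; rewrite scaler0 addr0.
Qed.

Lemma is_pos_tau x v : is_pos S x -> 0 <= tau (star v * x * v).
Proof.
by move=> [y ->]; rewrite mulrA -cstarM -mulrA; case: (tau_star_mul_ge0 (y * v)).
Qed.

Lemma tau_ge0 x : is_pos S x -> 0 <= tau x.
Proof. by move=> /(is_pos_tau 1); rewrite star1 mul1r mulr1. Qed.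

Lemma spectral_is_pos t e (c : C -> C) : spectral_family S t e ->
  (forall z, z \in t -> 0 <= c z) -> is_pos S (\sum_(z <- t) c z *: e z).
Proof.
move=> te c0; exists (\sum_(z <- t) sqrtC (c z) *: e z).
have [_ _ tp _] := te.
have -> : star (\sum_(z <- t) sqrtC (c z) *: e z) = \sum_(z <- t) sqrtC (c z) *: e z.
  rewrite star_sum; apply: eq_big_seq => z zt; have [_ _ [ez _]] := tp _ zt.
  by rewrite cstarZ ez conj_Creal // ger0_real // sqrtC_ge0 c0.
rewrite (mulr_spectral (fun z => sqrtC (c z)) (fun z => sqrtC (c z)) te).
by apply: eq_bigr => z _; rewrite -expr2 sqrtCK.
Qed.

(** For the converse, write [x = a + 'i *: k]. The form of [k] is the imaginary part of a
    nonnegative number, hence zero. Testing on spectral projections then gives [k = 0] and shows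
    that the eigenvalues of [a] are nonnegative. *)
Lemma is_posP x : is_pos S x <-> forall v, 0 <= tau (star v * x * v).
Proof.
split=> [xp v|]; first exact: is_pos_tau.
have [a [k [sa sk ->]]] := cartesian_decomposition S x => h.
have sandwich_real b v : star b = b -> tau (star v * b * v) \is Num.real.
  by move=> sb; apply: tau_real; rewrite !cstarM cstarK sb mulrA.
have k_form v : tau (star v * k * v) = 0.
  have /Creal_ImP := ger0_real (h v); rewrite mulrDr mulrDl -scalerAr -scalerAl tauD tauZ.
  by rewrite Im_rect ?sandwich_real.
(* Compressing by a spectral projection isolates its eigenvalue, weighted by the positive number
   [tau (e z)]. *)
have sandwich t e z : spectral_family S t e -> z \in t ->
    tau (star (e z) * (\sum_(w <- t) w *: e w) * e z) = z * tau (e z).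
  move=> te zt; have [ut _ /(_ _ zt)[_ _ [sz ez]] _] := te.
  rewrite sz tauC mulrA ez.
  have -> : e z = \sum_(w <- t) (w == z)%:R *: e w.
    rewrite (bigD1_seq z) //= eqxx scale1r big1 ?addr0 // => w /negPf->.
    by rewrite scale0r.
  rewrite (mulr_spectral _ _ te) (bigD1_seq z) //= eqxx mul1r big1 ?addr0.
    rewrite tauZ; congr (_ * tau _).
    rewrite (bigD1_seq z) //= eqxx scale1r big1 ?addr0 // => w /negPf->.
    by rewrite scale0r.
  by move=> w /negPf->; rewrite mul0r scale0r.
have k0 : k = 0.
  have [t [e [te kE]]] := spectral_theorem sk.
  rewrite kE big_seq big1 // => z zt.
  have /eqP := k_form (e z); rewrite kE sandwich // mulf_eq0.
  by rewrite (gt_eqF (spectral_tau_gt0 te zt)) orbF => /eqP->; rewrite scale0r.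
move: h; rewrite k0 scaler0 addr0 => h.
have [t [e [te aE]]] := spectral_theorem sa.
rewrite aE; apply: (spectral_is_pos (c := id) te) => z zt.
have := h (e z); rewrite aE sandwich // pmulr_lge0 //.
exact: spectral_tau_gt0 te zt.
Qed.

Lemma projC p : is_proj S p -> is_proj S (1 - p).
Proof.
move=> [sp pp]; split; first by rewrite starB star1 sp.
by rewrite mulrBl mul1r mulrBr mulr1 pp subrr subr0.
Qed.

Lemma proj_pos p : is_proj S p -> is_pos S p.
Proof. by move=> [sp pp]; exists p; rewrite sp pp. Qed.

Lemma tau_proj_mul_ge0 p x : is_proj S p -> is_pos S x -> 0 <= tau (p * x).
Proof.
by move=> [sp pp] /(is_pos_tau p); rewrite sp tauC mulrA pp.
Qed.

(** Both sides behave well under linear combinations in [w] and in [y], which reduces to projections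
    [p] and [q]. There [0 <= tau (p * f q) <= tau (f q) <= tau (f 1)], since [1 - p] and [1 - q] are
    projections too. *)
Lemma positive_map_bound (w y : A) : exists2 K : C, 0 <= K &
  forall f : 'End(A), positive_map S f -> `|tau (w * f y)| <= K * tau (f 1).
Proof.
have tau1 f : positive_map S f -> 0 <= tau (f 1).
  by move=> fp; apply/tau_ge0/fp; exists 1; rewrite star1 mulr1.
elim/(@proj_span_ind _ _ S): w => [|w w' [K K0 h] [K' K'0 h']|c w [K K0 h]|p pp].
- by exists 0 => // f _; rewrite mul0r linear0 normr0 mul0r.
- exists (K + K') => [|f fp]; first exact: addr_ge0.
  rewrite mulrDl tauD mulrDl; apply: le_trans (ler_normD _ _) _.
  by rewrite lerD ?h ?h'.
- exists (`|c| * K) => [|f fp]; first by rewrite mulr_ge0.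
  by rewrite -scalerAl tauZ normrM -mulrA ler_wpM2l ?h.
elim/(@proj_span_ind _ _ S): y => [|y y' [K K0 h] [K' K'0 h']|c y [K K0 h]|q qp].
- by exists 0 => // f _; rewrite !linear0 mulr0 linear0 normr0 mul0r.
- exists (K + K') => [|f fp]; first exact: addr_ge0.
  rewrite linearD /= mulrDr tauD mulrDl; apply: le_trans (ler_normD _ _) _.
  by rewrite lerD ?h ?h'.
- exists (`|c| * K) => [|f fp]; first by rewrite mulr_ge0.
  by rewrite linearZ /= -scalerAr tauZ normrM -mulrA ler_wpM2l ?h.
exists 1 => // f fp; rewrite mul1r.
have fq : is_pos S (f q) by apply/fp/proj_pos.
rewrite ger0_norm ?tau_proj_mul_ge0 //.
apply: (@le_trans _ _ (tau (f q))).
  rewrite -subr_ge0 -tauB -[X in X - _]mul1r -mulrBl.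
  exact/tau_proj_mul_ge0/fq/projC.
by rewrite -subr_ge0 -tauB -linearB /=; apply/tau_ge0/fp/proj_pos/projC.
Qed.

(** The bilinear form [tau (x * y)] is nondegenerate: if [x] is orthogonal to the whole basis, then
    [tau (x * star x) = 0], so [x = 0]. Its Gram matrix [G] is therefore invertible and every linear
    functional is represented. *)
Lemma coord_tau n (b : n.-tuple A) (i : 'I_n) : basis_of fullv b ->
  exists w, forall x, coord b i x = tau (w * x).
Proof.
move=> bb; pose G := \matrix_(k < n, l < n) tau (b`_k * b`_l).
have Gu : G \in unitmx.
  rewrite -row_free_unit -kermx_eq0; apply/eqP/row_matrixP => k.
  rewrite row0; have : row k (kermx G) *m G = 0 by rewrite -row_mul mulmx_ker row0.
  move: (row k _) => u uG.
  pose x := \sum_(l < n) u 0 l *: b`_l.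
  have xb (l : 'I_n) : tau (x * b`_l) = 0.
    have := congr1 (fun M : 'rV_n => M 0 l) uG; rewrite !mxE => uGl.
    rewrite -[RHS]uGl mulr_suml linear_sum; apply: eq_bigr => m _ /=.
    by rewrite -scalerAl tauZ mxE.
  have x0 : x = 0.
    apply: (can_inj (cstarK S)); rewrite (star0 S).
    apply: (tau_star_mul_ge0 _).2; rewrite cstarK.
    rewrite (coord_basis bb (memvf (star x))) mulr_sumr linear_sum big1 // => l _ /=.
    by rewrite -scalerAr tauZ xb mulr0.
  apply/rowP => l; rewrite mxE.
  by have /freeP := basis_free bb; apply.
exists (\sum_(k < n) invmx G i k *: b`_k) => x.
rewrite (coord_basis bb (memvf x)) mulr_sumr linear_sum linear_sum /=.
apply: eq_bigr => j _; rewrite -scalerAr linearZ /= tauZ; congr (_ * _).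
rewrite (coord_free _ _ (basis_free bb)) mulr_suml linear_sum /=.
have := congr1 (fun M : 'M_n => M i j) (mulVmx Gu); rewrite !mxE [j == i]eq_sym => <-.
by apply: eq_bigr => k _; rewrite -scalerAl tauZ mxE.
Qed.

End Trace.

(** * Null sequences of complex numbers *)

Section Limits.
Variable R : realType.
Local Notation C := R[i].
Implicit Types (u v : nat -> C) (z : C) (x : R).

Lemma cmodE z : (cmod z)%:C%C = `|z|. Proof. by case: z. Qed.

Lemma cmod_ge0 z : 0 <= cmod z. Proof. by rewrite -lecR cmodE normr_ge0. Qed.

Lemma cmod_gt0 z : z != 0 -> 0 < cmod z.
Proof. by rewrite -(ltcR 0) cmodE normr_gt0. Qed.

Lemma cmodD z1 z2 : cmod (z1 + z2) <= cmod z1 + cmod z2.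
Proof. exact: (@le_normcD R z1 z2). Qed.

Lemma cmodX z n : cmod (z ^+ n) = cmod z ^+ n.
Proof.
elim: n => [|n IH]; first by rewrite !expr0 ComplexField.Normc.normc1.
by rewrite !exprS ComplexField.Normc.normcM IH.
Qed.

Lemma cmodR x : cmod x%:C%C = `|x|.
Proof. by rewrite /ComplexField.Normc.normc /= expr0n addr0 sqrtr_sqr. Qed.

Lemma cmod_nat n : cmod (n%:R : C) = n%:R.
Proof. by rewrite -[n%:R](rmorph_nat (real_complex R)) cmodR normr_nat. Qed.

Lemma cmod_sum (I : Type) (s : seq I) (P : pred I) (F : I -> C) :
  cmod (\sum_(i <- s | P i) F i) <= \sum_(i <- s | P i) cmod (F i).
Proof.
elim/big_ind2: _ => [|z1 x1 z2 x2 h1 h2|//]; first by rewrite ComplexField.Normc.normc0.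
by apply: le_trans (cmodD _ _) _; exact: lerD.
Qed.

(** Convergence of [u] to [z] is expressed below as [to0 (fun n => u n - z)]. *)
Definition to0 u := forall e : R, 0 < e ->
  exists N, forall n, (N <= n)%N -> cmod (u n) < e.

Lemma to0_le u v : to0 v ->
  (exists N, forall n, (N <= n)%N -> cmod (u n) <= cmod (v n)) -> to0 u.
Proof.
move=> v0 [N1 uv] e /v0[N2 ve]; exists (maxn N1 N2) => n.
by rewrite geq_max => /andP[n1 n2]; exact: le_lt_trans (uv _ n1) (ve _ n2).
Qed.

Lemma to0_eq u v : to0 v -> (exists N, forall n, (N <= n)%N -> u n = v n) -> to0 u.
Proof. by move=> v0 [N uv]; apply: (to0_le v0); exists N => n /uv->. Qed.

Lemma to0_const0 : to0 (fun=> 0).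
Proof. by move=> e e0; exists 0%N => n _; rewrite ComplexField.Normc.normc0. Qed.

Lemma to0D u v : to0 u -> to0 v -> to0 (fun n => u n + v n).
Proof.
move=> u0 v0 e e0; have e2 : 0 < e / 2 by rewrite divr_gt0.
have [N1 h1] := u0 _ e2; have [N2 h2] := v0 _ e2; exists (maxn N1 N2) => n.
rewrite geq_max => /andP[n1 n2]; apply: le_lt_trans (cmodD _ _) _.
by rewrite [e]splitr ltrD ?h1 ?h2.
Qed.

Lemma to0Z z u : to0 u -> to0 (fun n => z * u n).
Proof.
(* Using [cmod z + 1] instead of [cmod z] avoids dividing by zero. *)
move=> u0 e e0; have z1 : 0 < cmod z + 1 by rewrite ltr_wpDl ?cmod_ge0.
have [N h] := u0 _ (divr_gt0 e0 z1); exists N => n /h un.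
rewrite ComplexField.Normc.normcM; apply: (@le_lt_trans _ _ ((cmod z + 1) * cmod (u n))).
  by rewrite ler_wpM2r ?cmod_ge0 // lerDl.
by rewrite mulrC -ltr_pdivlMr.
Qed.

Lemma to0M u v : to0 u -> to0 v -> to0 (fun n => u n * v n).
Proof.
move=> u0 v0; have [N un] := u0 _ ltr01; apply: (to0_le v0); exists N => n /un u1.
by rewrite ComplexField.Normc.normcM ler_piMl ?cmod_ge0 // ltW.
Qed.

Lemma to0_sum (I : Type) (s : seq I) (F : I -> nat -> C) :
  (forall i, to0 (F i)) -> to0 (fun n => \sum_(i <- s) F i n).
Proof.
move=> F0; elim: s => [|i s IH].
  by apply: (to0_eq to0_const0); exists 0%N => n _; rewrite big_nil.
by apply: (to0_eq (to0D (F0 i) IH)); exists 0%N => n _; rewrite big_cons.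
Qed.

Lemma to0_bounded_div u x : (forall n, cmod (u n) <= x) ->
  to0 (fun n => n%:R^-1 * u n).
Proof.
move=> ux e e0; have x0 : 0 <= x by exact: le_trans (cmod_ge0 _) (ux 0%N).
exists (Num.bound (x / e)).+1 => n ln.
have n0 : 0 < n%:R :> R by rewrite ltr0n (leq_trans _ ln).
rewrite ComplexField.Normc.normcM ComplexField.Normc.normcV cmod_nat mulrC ltr_pdivrMr // mulrC.
apply: le_lt_trans (ux n) _; rewrite -ltr_pdivrMr //.
apply: lt_trans (archi_boundP _) _; first by rewrite divr_ge0 // ltW.
by rewrite ltr_nat.
Qed.

(** Split at an index [N1] past which the terms are below [e / 2]: the initial part [v] stays
    bounded and is killed by the division by [n], while the mean of the tail [w] is at most
    [e / 2]. *)
Lemma to0_cesaro u : to0 u -> to0 (fun n => n%:R^-1 * \sum_(1 <= k < n.+1) u k).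
Proof.
move=> u0 e e0; have e2 : 0 < e / 2 by rewrite divr_gt0.
have [N1 h1] := u0 _ e2.
pose v n := \sum_(1 <= k < n.+1 | (k < N1)%N) u k.
pose w n := \sum_(1 <= k < n.+1 | ~~ (k < N1)%N) u k.
have vb n : cmod (v n) <= \sum_(k < N1) cmod (u k).
  apply: le_trans (cmod_sum _ _ _) _.
  rewrite big_mkcond /=; set g := fun k : nat => if (k < N1)%N then cmod (u k) else 0.
  have g0 k : 0 <= g k by rewrite /g; case: ifP => // _; exact: cmod_ge0.
  (* The larger range contains both [[1, n]] and [[0, N1)], whatever the order of [n] and [N1]. *)
  apply: (@le_trans _ _ (\sum_(0 <= k < n.+1 + N1) g k)).
    rewrite [leRHS](@big_cat_nat _ _ _ n.+1 0%N) ?leq_addr //= [X in _ <= X + _]big_ltn //.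
    by rewrite addrAC lerDr addr_ge0 // sumr_ge0.
  rewrite (@big_cat_nat _ _ _ N1 0%N) ?leq_addl //=.
  rewrite [X in _ + X]big_nat_cond [X in _ + X]big1 ?addr0.
    by rewrite big_mkord ler_sum // => k _; rewrite /g ltn_ord.
  by move=> k /andP[/andP[Nk _] _]; rewrite /g ltnNge Nk.
have [N2 h2] := to0_bounded_div vb e2.
exists (maxn 1 N2) => n; rewrite geq_max => /andP[n0 n2].
rewrite (bigID (fun k => (k < N1)%N)) /= -/(v n) -/(w n) mulrDr [e]splitr.
apply: le_lt_trans (cmodD _ _) _; apply: ltr_leD; first exact: h2.
rewrite ComplexField.Normc.normcM ComplexField.Normc.normcV cmod_nat mulrC ler_pdivrMr ?ltr0n //.
apply: le_trans (cmod_sum _ _ _) _.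
apply: (@le_trans _ _ (\sum_(1 <= k < n.+1) (e / 2))).
  rewrite big_mkcond /=; apply: ler_sum => k _.
  by case: ltnP => [_|/h1/ltW//]; rewrite /= ltW.
by rewrite sumr_const_nat subn1 mulr_natr.
Qed.

Lemma to0_expr z : cmod z < 1 -> to0 (fun n => z ^+ n).
Proof.
move=> z1 e e0; have [z0|z0] := eqVneq (cmod z) 0.
  by exists 1%N => n n1; rewrite cmodX z0 expr0n gtn_eqF.
have zp : 0 < cmod z by rewrite lt_neqAle eq_sym z0 cmod_ge0.
(* With [cmod z = (1 + h)^-1], Bernoulli's inequality makes the inverse powers grow at least
   linearly. *)
pose h := (cmod z)^-1 - 1; have h0 : 0 < h by rewrite subr_gt0 invf_gt1.
have bernoulli n : h *+ n < (1 + h) ^+ n.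
  elim: n => [|n IH]; first by rewrite mulr0n expr0 ltr01.
  have h1 : 1 <= (1 + h) ^+ n by rewrite exprn_ege1 // lerDl ltW.
  rewrite exprS mulrDl mul1r mulrSr ltr_leD //.
  by rewrite ler_peMr // ltW.
exists (Num.bound (h^-1 * e^-1)) => n ln; rewrite cmodX.
have zE : cmod z = (1 + h)^-1 by rewrite /h addrCA subrr addr0 invrK.
have h1 : 0 < 1 + h by exact: addr_gt0.
rewrite zE exprVn invf_plt ?posrE ?exprn_gt0 //.
apply: lt_trans (bernoulli n); rewrite -mulr_natl -ltr_pdivrMr // mulrC.
apply: lt_le_trans (archi_boundP _) _; last by rewrite ler_nat.
by rewrite mulr_ge0 // invr_ge0 ltW.
Qed.

Lemma Re_le_cmod z : `|complex.Re z| <= cmod z.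
Proof.
case: z => a b; rewrite /ComplexField.Normc.normc /= -sqrtr_sqr.
by rewrite ler_sqrt ?lerDl ?addr_ge0 ?sqr_ge0.
Qed.

Lemma Im_le_cmod z : `|complex.Im z| <= cmod z.
Proof.
case: z => a b; rewrite /ComplexField.Normc.normc /= -sqrtr_sqr.
by rewrite ler_sqrt ?lerDr ?addr_ge0 ?sqr_ge0.
Qed.

(** [0 <= z] means that the imaginary part is zero and the real part nonnegative. If either fails,
    every nonnegative [y] is at distance at least [|Im z|], respectively [|Re z|], from [z]. *)
Lemma to0_lim_ge0 u z : to0 (fun n => u n - z) ->
  (forall n, (0 < n)%N -> 0 <= u n) -> 0 <= z.
Proof.
move=> uz u0.
have approx (e : R) : 0 < e -> exists2 y : C, 0 <= y & cmod (y - z) < e.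
  move=> /uz[N h]; exists (u N.+1); first exact: u0.
  exact/h/leqnSn.
rewrite lecE /=; apply/andP; split.
  apply/negPn/negP => zi; have /approx[y] : 0 < `|complex.Im z| by rewrite normr_gt0.
  rewrite lecE /= => /andP[/eqP yi _]; rewrite ltNge => /negP; apply.
  have := Im_le_cmod (y - z); rewrite -normrN.
  by case: (y) (z) yi => a b [c d] /= ->; rewrite sub0r opprK.
rewrite leNgt; apply/negP => zr.
have /approx[y] : 0 < `|complex.Re z| by rewrite normr_gt0 lt_eqF.
rewrite lecE /= => /andP[_ yr]; rewrite ltNge => /negP; apply.
apply: le_trans (Re_le_cmod _); rewrite ltr0_norm //; apply: le_trans (ler_norm _).
by case: (y) (z) yr => a b [c d] /= a0; rewrite lerDr.
Qed.

Lemma to0_lim_unique u z1 z2 :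
  to0 (fun n => u n - z1) -> to0 (fun n => u n - z2) -> z1 = z2.
Proof.
move=> h1 h2; have h : to0 (fun=> z1 - z2).
  apply: (to0_eq (to0D h2 (to0Z (-1) h1))); exists 0%N => n _.
  by ring.
apply/eqP; rewrite -subr_eq0; apply/negPn/negP => z0.
by have [N /(_ N (leqnn _))] := h _ (cmod_gt0 z0); rewrite ltxx.
Qed.

Lemma to0_cesaro_lim u z : to0 (fun n => u n - z) ->
  to0 (fun n => n%:R^-1 * (\sum_(1 <= k < n.+1) u k) - z).
Proof.
move=> /to0_cesaro h; apply: (to0_eq h); exists 1%N => n n1.
rewrite sumrB mulrBr sumr_const_nat subn1 /= -[z *+ n]mulr_natl mulKf //.
by rewrite pnatr_eq0 -lt0n.
Qed.

(** The geometric sums are bounded by [2 / cmod (z - 1)]. *)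
Lemma to0_cesaro_expr z : cmod z = 1 -> z != 1 ->
  to0 (fun n => n%:R^-1 * \sum_(1 <= k < n.+1) z ^+ k).
Proof.
move=> cz z1; apply: (to0_bounded_div (x := 2 / cmod (z - 1))) => n.
have zB : z - 1 != 0 by rewrite subr_eq0.
have -> : \sum_(1 <= k < n.+1) z ^+ k = z * (z ^+ n - 1) / (z - 1).
  rewrite subrX1 mulrCA mulrAC mulfV // mul1r mulr_sumr big_add1 /= big_mkord.
  by apply: eq_bigr => k _; rewrite exprS.
rewrite !ComplexField.Normc.normcM ComplexField.Normc.normcV cz mul1r.
rewrite ler_wpM2r ?invr_ge0 ?cmod_ge0 //; apply: le_trans (cmodD _ _) _.
by rewrite cmodX cz expr1n -[-1]mulN1r mulr1 -[(-1 : C)]/(-1%:C)%C -rmorphN cmodR normrN1.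
Qed.

End Limits.

(** * Powers of Jordan matrices *)

Section BinomialGrowth.
Variable R : realType.
Local Notation C := R[i].
Implicit Types (z : C) (r : R).

(* The entry at distance [t] from the diagonal in the [k]-th power of a Jordan block for [z]. *)
Definition bpow t z k : C := 'C(k, t)%:R * z ^+ (k - t).

Lemma bpowS t z k : z * bpow t.+1 z k + bpow t z k = bpow t.+1 z k.+1.
Proof.
rewrite /bpow binS natrD mulrDl subSS; congr (_ + _).
have [tk|kt] := ltnP t k; last by rewrite bin_small ?mul0r ?mulr0.
by rewrite mulrCA -exprS subnSK.
Qed.

Lemma cmod_bpow t z k : cmod (bpow t z k) = 'C(k, t)%:R * cmod z ^+ (k - t).
Proof. by rewrite ComplexField.Normc.normcM cmod_nat cmodX. Qed.

Lemma bpow_neq0 t z k : z != 0 -> (t <= k)%N -> bpow t z k != 0.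
Proof.
by move=> z0 tk; rewrite mulf_neq0 ?expf_neq0 // pnatr_eq0 -lt0n bin_gt0.
Qed.

(** ['C(k, t) * a ^ (k - t) * e ^ t] is a single term of the binomial expansion of [(a + e) ^ k]. *)
Lemma bpow_le_geom t (a e : R) k : 0 <= a -> 0 < e ->
  'C(k, t)%:R * a ^+ (k - t) <= (a + e) ^+ k / e ^+ t.
Proof.
move=> a0 e0; rewrite ler_pdivlMr ?exprn_gt0 //.
have [tk|kt] := leqP t k; last first.
  by rewrite bin_small // !mul0r exprn_ge0 // addr_ge0 // ltW.
rewrite exprDn (bigD1 (Ordinal (tk : t < k.+1)%N)) //=.
rewrite -mulrA mulr_natl lerDl sumr_ge0 // => i _.
by rewrite mulrn_wge0 // mulr_ge0 // exprn_ge0 // ltW.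
Qed.

Lemma to0_bpow_lt s t z r : cmod z < r ->
  to0 (fun k => bpow t z k / bpow s r%:C%C k).
Proof.
move=> zr; have z0 := cmod_ge0 z.
have r0 : 0 < r := le_lt_trans z0 zr.
have [e e0 er] : exists2 e, 0 < e & cmod z + e < r.
  exists ((r - cmod z) / 2); first by rewrite divr_gt0 ?subr_gt0.
  by rewrite -ltrBrDl ltr_pdivrMr // mulr_natr mulr2n ltrDl subr_gt0.
(* The numerator is at most [(cmod z + e) ^ k / e ^ t] and the denominator at least [r ^ (k - s)];
   their quotient is [c * q ^ k] with [q < 1]. *)
pose q := (cmod z + e) / r; pose c := r ^+ s / e ^+ t.
have q0 : 0 <= q by rewrite divr_ge0 ?addr_ge0 // ltW.
have c0 : 0 <= c by rewrite divr_ge0 ?exprn_ge0 // ltW.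
have g1 : cmod q%:C%C < 1 by rewrite cmodR ger0_norm // ltr_pdivrMr // mul1r.
apply: (to0_le (to0Z c%:C%C (to0_expr g1))); exists s => k sk.
have -> : cmod (c%:C%C * q%:C%C ^+ k) = c * q ^+ k.
  by rewrite ComplexField.Normc.normcM cmodX !cmodR !ger0_norm.
rewrite ComplexField.Normc.normcM ComplexField.Normc.normcV !cmod_bpow.
rewrite cmodR (gtr0_norm r0) /q /c.
apply: (@le_trans _ _ ((cmod z + e) ^+ k / e ^+ t / r ^+ (k - s))).
  apply: ler_pM; rewrite ?invr_ge0 ?mulr_ge0 ?exprn_ge0 ?bpow_le_geom ?(ltW r0) //.
  rewrite lef_pV2 ?posrE ?mulr_gt0 ?exprn_gt0 ?ltr0n ?bin_gt0 //.
  by rewrite ler_peMl ?exprn_ge0 ?(ltW r0) // ler1n bin_gt0.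
have rk : r ^+ k = r ^+ (k - s) * r ^+ s by rewrite -exprD subnK.
rewrite expr_div_n rk le_eqVlt; apply/orP; left; apply/eqP.
by field; rewrite !expf_neq0 ?gt_eqF.
Qed.

Lemma to0_shift (u : nat -> C) t : to0 u -> to0 (fun k => u (k - t)%N).
Proof.
move=> u0 e /u0[N h]; exists (N + t)%N => k Nk.
by apply: h; rewrite leq_subRL ?(leq_trans (leq_addl _ _) Nk) // addnC.
Qed.

Lemma to0_bpow_index z t s : z != 0 -> (t < s)%N ->
  to0 (fun k => bpow t z k / bpow s z k).
Proof.
move=> z0.
(* The ratio of consecutive terms is [m.+1 * z / (k - m)]. The general case is a telescoping product
   of such ratios. *)
have step m : to0 (fun k => bpow m z k / bpow m.+1 z k).
  have inv0 : to0 (fun k => k%:R^-1 * (m.+1%:R * z)).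
    by apply: (@to0_bounded_div _ (fun=> m.+1%:R * z)).
  apply: (to0_eq (to0_shift m inv0)).
  exists m.+1 => k mk; have mk' := ltnW mk.
  have k0 : (k - m)%:R != 0 :> C by rewrite pnatr_eq0 subn_eq0 -ltnNge.
  have c0 : 'C(k, m.+1)%:R != 0 :> C by rewrite pnatr_eq0 -lt0n bin_gt0.
  have e : m.+1%:R * 'C(k, m.+1)%:R = (k - m)%:R * 'C(k, m)%:R :> C.
    by rewrite -!natrM mul_bin_left.
  rewrite /bpow; have -> : 'C(k, m)%:R = m.+1%:R * 'C(k, m.+1)%:R / (k - m)%:R :> C.
    by rewrite e mulrAC mulfV ?mul1r.
  rewrite -(subnSK mk) exprS; set y := z ^+ _; have y0 : y != 0 by rewrite expf_neq0.
  rewrite subnSK //; move: k0 c0.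
  move: ((k - m)%:R : C) ('C(k, m.+1)%:R : C) (m.+1%:R : C) => p q w p0 q0.
  by field; rewrite ?p0 ?q0 ?y0.
elim: s => // s IH; rewrite ltnS leq_eqVlt => /orP[/eqP->|/IH h]; first exact: step.
apply: (to0_eq (to0M h (step s))); exists s => k sk.
by rewrite mulrA divfK // bpow_neq0.
Qed.

(** Replacing [r] by [z] in the denominator does not change its modulus. *)
Lemma to0_bpow_radius z r t s : cmod z = r -> 0 < r -> (t < s)%N ->
  to0 (fun k => bpow t z k / bpow s r%:C%C k).
Proof.
move=> zr r0 ts; have z0 : z != 0.
  by apply: contraTneq r0 => z0; rewrite -zr z0 ComplexField.Normc.normc0 ltxx.
apply: (to0_le (to0_bpow_index z0 ts)); exists 0%N => k _.
rewrite !ComplexField.Normc.normcM !ComplexField.Normc.normcV !ComplexField.Normc.normcM.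
by rewrite !cmodX cmodR -zr ger0_norm ?cmod_ge0.
Qed.

End BinomialGrowth.

(** * Chains and powers of a Jordan matrix, with natural number indices *)

Section JordanMatrix.
Variables (R : realType) (A : falgType R[i]).
Local Notation C := R[i].
Local Notation n := (\dim {:A}).
Implicit Types (M X Y : 'M[C]_n) (i j l m t k : nat).

Lemma mxeE M (i j : 'I_n) : mxe M i j = M i j.
Proof. by rewrite /mxe !valK. Qed.

Lemma mxe_out1 M i j : (n <= i)%N -> mxe M i j = 0.
Proof. by move=> ni; rewrite /mxe insubF // ltnNge ni. Qed.

Lemma mxe_out2 M i j : (n <= j)%N -> mxe M i j = 0.
Proof. by move=> nj; rewrite /mxe [insub j]insubF ?ltnNge ?nj //; case: insub. Qed.

Lemma mxe_mul X Y i j : mxe (X *m Y) i j = \sum_(l < n) mxe X i l * mxe Y l j.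
Proof.
have [ni|iN] := leqP n i.
  by rewrite mxe_out1 // big1 // => l _; rewrite mxe_out1 ?mul0r.
have [nj|jN] := leqP n j.
  by rewrite mxe_out2 // big1 // => l _; rewrite (@mxe_out2 Y) ?mulr0.
rewrite (mxeE _ (Ordinal iN) (Ordinal jN)) mxE; apply: eq_bigr => l _.
by rewrite -!mxeE.
Qed.

Lemma mxe1 i j : mxe (1%:M : 'M[C]_n) i j = ((i == j) && (i < n)%N)%:R.
Proof.
have [ni|iN] := leqP n i; first by rewrite mxe_out1 // andbF.
have [nj|jN] := leqP n j.
  by rewrite mxe_out2 // andbT; case: eqP => // ij; rewrite -ij leqNgt iN in nj.
by rewrite (mxeE _ (Ordinal iN) (Ordinal jN)) mxE andbT.
Qed.

Variable M : 'M[C]_n.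
Hypothesis MJ : is_jordan M.

(** Row [i] of a Jordan matrix is supported on columns [i] and [i.+1]. In the last row the default
    value 0 of [mxe] disposes of the second term. *)
Lemma jordan_mul X i j :
  mxe (M *m X) i j = mxe M i i * mxe X i j + mxe M i i.+1 * mxe X i.+1 j.
Proof.
rewrite mxe_mul (bigID (fun l : 'I_n => l == i :> nat)) /=.
rewrite [X in X + _](big_ord1_eq _ (fun l => mxe M i l * mxe X l j)).
rewrite [X in _ + X](bigID (fun l : 'I_n => l == i.+1 :> nat)) /=.
rewrite [X in _ + (_ + X)]big1 ?addr0; last first.
  by move=> l /andP[/eqP li /eqP li1]; rewrite MJ.1 ?mul0r.
rewrite (eq_bigl (fun l : 'I_n => l == i.+1 :> nat)); last first.
  by move=> l /=; case: (l =P i.+1 :> nat) => [->|]; rewrite ?andbF // gtn_eqF.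
rewrite (big_ord1_eq _ (fun l => mxe M i l * mxe X l j)).
by congr (_ + _); case: ltnP => // h; rewrite (@mxe_out1 X) ?mulr0.
Qed.

Lemma jchainP z i m : reflect
  [/\ (i + m <= n)%N, mxe M i i = z &
      forall t, (t.+1 < m)%N -> mxe M (i + t) (i + t).+1 = 1] (jchain M z i m).
Proof.
apply: (iffP and3P) => [[im /eqP zi /forallP h]|[im zi h]]; split => //.
- move=> t tm; have tn : (t < n)%N by apply: leq_trans im; rewrite ltn_addl // ltnW.
  by have /implyP/(_ tm)/eqP := h (Ordinal tn).
- exact/eqP.
- by apply/forallP => t; apply/implyP => /h/eqP.
Qed.

Lemma jchain1 i : jchain M (mxe M i i) i 1 = (i < n)%N.
Proof. by apply/jchainP/idP => [[]|]; rewrite addn1. Qed.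

Lemma jchain_leq z i m : jchain M z i m -> (i + m <= n)%N.
Proof. by case/jchainP. Qed.

Lemma jchain_consP z i m :
  reflect [/\ mxe M i i = z, mxe M i i.+1 = 1 & jchain M z i.+1 m.+1]
          (jchain M z i m.+2).
Proof.
apply: (iffP (jchainP _ _ _)) => [[im zi h]|[zi i1 /jchainP[im z1 h]]].
  have i1 : mxe M i i.+1 = 1 by have := h 0%N; rewrite addn0; apply.
  split => //; apply/jchainP; split; first by rewrite addSnnS.
    have [i0|[_ <-//]] := MJ.2 i; move: i1; rewrite i0 => /eqP.
    by rewrite eq_sym oner_eq0.
  by move=> t tm; rewrite addSnnS; apply: h.
split => //; first by rewrite -addSnnS.
by case=> [|t] tm; rewrite ?addn0 // -addSnnS; apply: h.
Qed.

(** The two chains share the position [i + m], hence the total length [m + p] and not [m.+1 + p].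
    This is how chains are prolonged beyond the maximal length to reach contradictions. *)
Lemma jchain_cat z w i m p : jchain M z i m.+1 -> jchain M w (i + m) p ->
  jchain M z i (m + p).
Proof.
elim: m i => [|m IH] i.
  by rewrite addn0 add0n => /jchainP[_ <- _] /[dup] /jchainP[_ -> _].
move=> /jchain_consP[zi i1 h]; rewrite -addSnnS => /(IH _ h).
rewrite addSn; case: (m + p)%N => [_|q h2]; last exact/jchain_consP.
by rewrite -zi jchain1 (leq_trans _ (jchain_leq h)) // leq_addr.
Qed.

(** The condition says that [i] and [j] lie in one block, in this order. Above the diagonal the
    induction on [k] is Pascal's rule [bpowS]. *)
Lemma jordan_expr k i j : mxe (iter k (mulmx M) 1%:M) i j =
  if (i <= j)%N && jchain M (mxe M i i) i (j - i).+1
  then bpow (j - i) (mxe M i i) k else 0.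
Proof.
elim: k i j => [|k IH] i j.
  rewrite /= mxe1; case: (ltngtP i j) => //= [ij|<-]; last first.
    by rewrite subnn jchain1 /bpow bin0 expr0 mulr1; case: ifP.
  by rewrite -(subnSK ij) /bpow bin0n mul0r if_same.
rewrite iterS jordan_mul !IH; case: (ltngtP i j) => [ij|ij|<-] /=.
- rewrite -(subnSK ij); have [i0|[i1 ii]] := MJ.2 i.
    rewrite i0 mul0r addr0 (_ : jchain _ _ _ _ = false) ?mulr0 //.
    by apply/jchain_consP => -[_ /eqP]; rewrite i0 eq_sym oner_eq0.
  rewrite i1 mul1r -ii; case: ifP => [/jchain_consP[_ _ ->]|h]; first exact: bpowS.
  case: ifP => [h2|_]; last by rewrite mulr0 addr0.
  by move: h; rewrite (introT (jchain_consP _ _ _)).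
- by rewrite !mulr0 addr0.
- rewrite mulr0 addr0 subnn; case: ifP => _; last by rewrite mulr0.
  by rewrite /bpow !bin0 !mul1r !subn0 exprS.
Qed.

Lemma jchain_le_dphi r z i m : jchain M z i m -> (i < n)%N -> cmod z = r ->
  (m <= dphi M r)%N.
Proof.
move=> h iN zr; have [im zi _] := jchainP _ _ _ h.
have mn : (m < n.+1)%N by rewrite ltnS (leq_trans _ im) // leq_addl.
have zE : M (Ordinal iN) (Ordinal iN) = z by rewrite -mxeE.
apply: leq_trans (leq_bigmax_cond (Ordinal iN) _); last by rewrite zE zr.
rewrite zE; apply: leq_trans (leq_bigmax (Ordinal iN)).
exact: (@leq_bigmax_cond _ _ (fun p : 'I_n.+1 => p : nat) (Ordinal mn)).
Qed.

(** The chain of length one at [i] shows that the maximum is positive. If no chain reached it, all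
    of them would be bounded by its predecessor. *)
Lemma dphi_attained r i : (i < n)%N -> cmod (mxe M i i) = r ->
  (0 < dphi M r)%N /\ exists z j, cmod z = r /\ jchain M z j (dphi M r).
Proof.
move=> iN zr; have d0 : (0 < dphi M r)%N.
  by apply: (@jchain_le_dphi r (mxe M i i) i); rewrite ?jchain1.
split=> //; apply: boolp.contrapT => H.
suff : (dphi M r <= (dphi M r).-1)%N by rewrite leqNgt prednK ?leqnn.
rewrite {1}/dphi; apply/bigmax_leqP => j /eqP jr; apply/bigmax_leqP => l _.
apply/bigmax_leqP => m lm; rewrite -ltnS prednK // ltn_neqAle.
rewrite (jchain_le_dphi lm) // andbT; apply/eqP => md.
by apply: H; exists (M j j), l; rewrite -md.
Qed.

End JordanMatrix.

(** * Matrices of linear maps in a basis *)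

Section MatrixOf.
Variables (R : realType) (A : falgType R[i]).
Local Notation C := R[i].
Local Notation n := (\dim {:A}).
Variable b : n.-tuple A.
Hypothesis bb : basis_of fullv b.
Implicit Types (f g : 'End(A)) (x : A).

Lemma matofE f (i j : 'I_n) : matof b f i j = coord b i (f b`_j).
Proof. by rewrite !mxE /= passmx.vecof_delta. Qed.

Lemma coord_matof f x (i : 'I_n) :
  coord b i (f x) = \sum_(j < n) matof b f i j * coord b j x.
Proof.
rewrite {1}(coord_basis bb (memvf x)) !linear_sum /=.
by apply: eq_bigr => j _; rewrite !linearZ /= matofE mulrC.
Qed.

Lemma matof_comp f g : matof b (f \o g)%VF = matof b f *m matof b g.
Proof. by rewrite /matof (passmx.mxof_comp _ _ bb) trmx_mul. Qed.

Lemma matof_scale z f : matof b (z *: f) = z *: matof b f.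
Proof. by apply/matrixP => i j; rewrite [RHS]mxE !matofE lfunE /= linearZ. Qed.

Lemma matof_sub f g : matof b (f - g) = matof b f - matof b g.
Proof.
apply/matrixP => i j; rewrite [RHS]mxE [X in _ = _ + X]mxE !matofE.
by rewrite add_lfunE opp_lfunE linearB.
Qed.

Lemma matof_inj : injective (matof b).
Proof. by move=> f g /trmx_inj /(can_inj (passmx.mxofK bb bb)). Qed.

Lemma matof_surj (P : 'M[C]_n) : exists f, matof b f = P.
Proof. by exists (passmx.hommx b b P^T); rewrite /matof passmx.hommxK // trmxK. Qed.

Lemma matof_lpow f k : matof b (lpow f k) = iter k (mulmx (matof b f)) 1%:M.
Proof.
elim: k => [|k IH] /=; last by rewrite matof_comp IH.
by rewrite /matof passmx.mxof1 ?trmx1 // (basis_free bb).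
Qed.

Lemma matof_cesaro f N (i j : 'I_n) : matof b (cesaro f b N) i j =
  N%:R^-1 * \sum_(1 <= k < N.+1)
    ((bnorm b (lpow f k))^-1)%:C%C * mxe (iter k (mulmx (matof b f)) 1%:M) i j.
Proof.
rewrite matofE /cesaro lfunE /= linearZ /= sum_lfunE linear_sum /=; congr (_ * _).
by apply: eq_bigr => k _; rewrite lfunE /= linearZ /= mxeE -matof_lpow matofE.
Qed.

Lemma cmod_le_bnorm f (i j : 'I_n) : cmod (matof b f i j) <= bnorm b f.
Proof.
apply: le_trans (le_bigmax _ (fun i => \big[Num.max/0]_(j < n) cmod (matof b f i j)) i).
exact: (le_bigmax _ (fun j => cmod (matof b f i j)) j).
Qed.

Lemma bnorm_le f (B : R) : 0 <= B ->
  (forall i j : 'I_n, cmod (matof b f i j) <= B) -> bnorm b f <= B.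
Proof. by move=> B0 h; apply: bigmax_le => // i _; apply: bigmax_le. Qed.

Lemma maximal_part_to0 f psi : maximal_part f b psi <->
  forall i j : 'I_n, to0 (fun N => matof b (cesaro f b N) i j - matof b psi i j).
Proof.
split=> [h i j e /h[N0 hN]|h e e0].
  by exists N0 => N /hN/(_ i j); rewrite matof_sub !mxE.
(* There are finitely many entries, so the maximum of their thresholds serves them all. *)
have [F hF] := @fin_all_exists _ _ (fun (ij : 'I_n * 'I_n) N0 => forall N, (N0 <= N)%N ->
  cmod (matof b (cesaro f b N) ij.1 ij.2 - matof b psi ij.1 ij.2) < e)
  (fun ij => h ij.1 ij.2 e e0).
exists (\max_ij F ij) => N FN i j; rewrite matof_sub.
have := hF (i, j) N (leq_trans (leq_bigmax (i, j)) FN).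
by rewrite !mxE.
Qed.

End MatrixOf.

(** * The matrix of the maximal part in a Jordan basis *)

Section JordanMap.
Variables (R : realType) (A : falgType R[i]) (phi : 'End(A)) (r : R).
Local Notation C := R[i].
Local Notation n := (\dim {:A}).
Variable b : n.-tuple A.
Hypotheses (sr : spectral_radius phi r) (r0 : 0 < r) (jb : jordan_basis phi b).
Local Notation M := (matof b phi).
Local Notation d := (dphi M r).
Let bb : basis_of fullv b := jb.1.
Let MJ : is_jordan M := jb.2.
Implicit Types (i j k l : nat) (x : A) (z : C).

Lemma leigenvalueP z :
  reflect (exists2 x, x != 0 & phi x = z *: x) (passmx.leigenvalue phi z).
Proof.
have kerE x : (x \in passmx.leigenspace phi z) = (phi x == z *: x).
  by rewrite memv_ker add_lfunE opp_lfunE scale_lfunE id_lfunE subr_eq0.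
apply: (iffP idP) => [h|[x x0 /eqP]].
  exists (vpick (passmx.leigenspace phi z)); first by rewrite vpick0.
  by apply/eqP; rewrite -kerE memv_pick.
by rewrite -kerE; apply: contraTneq => ->; rewrite memv0.
Qed.

(** Row [k] of the eigenvector equation links coordinates [k] and [k.+1]. Going down from the last
    row, coordinate [k.+1] either has coefficient 0 or belongs to the same diagonal value and is
    already known to vanish. *)
Lemma coord_eigenvector_eq0 x z (i : 'I_n) : phi x = z *: x ->
  M i i != z -> coord b i x = 0.
Proof.
(* All columns of [X x] are the coordinate vector of [x]; a square matrix lets [jordan_mul]
   apply. *)
move=> xz Miz; pose X x : 'M[C]_n := \matrix_(i, j) coord b i x.
have MX y : M *m X y = X (phi y).
  apply/matrixP => k l; rewrite !mxE coord_matof //; apply: eq_bigr => m _.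
  by congr (_ * _); rewrite mxE.
suff h m k : (n - k <= m)%N -> mxe M k k != z -> mxe (X x) k i = 0.
  have XE : mxe (X x) i i = coord b i x by rewrite mxeE mxE.
  by rewrite -XE (h n) ?leq_subr ?mxeE.
elim: m k => [|m IH] k; first by rewrite leqn0 subn_eq0 => ? _; rewrite mxe_out1.
move=> km kz; have Xz : mxe (X (phi x)) k i = z * mxe (X x) k i.
  rewrite xz /mxe; case: insub => [k'|]; last by rewrite mulr0.
  by rewrite valK !mxE linearZ.
have := jordan_mul MJ (X x) k i; rewrite MX Xz => /eqP.
have -> : mxe M k k.+1 * mxe (X x) k.+1 i = 0.
  have [->|[_ ke]] := MJ.2 k; first by rewrite mul0r.
  by rewrite IH ?mulr0 -?ke // subnS -subn1 leq_subLR add1n.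
rewrite addr0 -subr_eq0 -mulrBl mulf_eq0 subr_eq0 eq_sym (negPf kz) /=.
by move/eqP.
Qed.

Lemma eigenvalue_on_diag z : passmx.leigenvalue phi z -> exists i : 'I_n, M i i = z.
Proof.
move=> /leigenvalueP[x x0 xz]; apply: boolp.contrapT => h; case/eqP: x0.
rewrite (coord_basis bb (memvf x)) big1 // => i _.
rewrite (coord_eigenvector_eq0 xz) ?scale0r //.
by apply/eqP => Mi; apply: h; exists i.
Qed.

Lemma block_start (i : 'I_n) : (forall l, l.+1 = i -> mxe M l l.+1 = 0) ->
  passmx.leigenvalue phi (M i i).
Proof.
move=> h; apply/leigenvalueP; exists b`_i.
  apply/eqP => bi0; have /freeP/(_ (fun j : 'I_n => (j == i)%:R)) := basis_free bb.
  rewrite (bigD1 i) //= eqxx scale1r bi0 big1 ?addr0 => [/(_ erefl i)/eqP|j /negPf->].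
    by rewrite eqxx oner_eq0.
  by rewrite scale0r.
rewrite {1}(coord_basis bb (memvf (phi b`_i))) (bigD1 i) //= -matofE.
rewrite big1 ?addr0 // => l li; rewrite -matofE -mxeE.
have [il|il] := eqVneq (l.+1) i; first by rewrite -il h // scale0r.
rewrite MJ.1 ?scale0r //; first by move=> e; rewrite (ord_inj e) eqxx in li.
by move=> e; rewrite e eqxx in il.
Qed.

(** Either [i] starts a block, and then its basis vector is an eigenvector, or its diagonal entry
    equals the preceding one. *)
Lemma diag_eigenvalue (i : 'I_n) : passmx.leigenvalue phi (M i i).
Proof.
case: i => i; elim: i => [|i IH] iN; set p := Ordinal iN; last first.
  have [h|[_ h]] := MJ.2 i; last by have := IH (ltnW iN); rewrite -!mxeE /= h.
  apply: block_start => l /= [->]; exact: h.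
exact: block_start.
Qed.

Lemma cmod_diag_le i : cmod (mxe M i i) <= r.
Proof.
have [ni|iN] := leqP n i.
  by rewrite mxe_out1 // ComplexField.Normc.normc0 ltW.
by rewrite (mxeE _ (Ordinal iN) (Ordinal iN)); apply/sr.2/diag_eigenvalue.
Qed.

Lemma top_diag : exists i : 'I_n, cmod (M i i) = r.
Proof. by have [[z /eigenvalue_on_diag[i <-] zr] _] := sr; exists i. Qed.

Lemma dphi_gt0 : (0 < d)%N.
Proof.
by have [i ir] := top_diag; apply: (dphi_attained (ltn_ord i) _).1; rewrite ?mxeE.
Qed.

Local Notation s := d.-1.
Local Notation Mpow k := (iter k (mulmx M) 1%:M).

(** These are the upper right corners of the blocks of maximal size among those with eigenvalue of
    modulus [r]: the entries of the powers with the fastest growth. *)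
Definition critical i j :=
  [&& j == (i + s)%N, cmod (mxe M i i) == r & jchain M (mxe M i i) i d].

Lemma critical_entry i j k : critical i j ->
  mxe (Mpow k) i j = bpow s (mxe M i i) k.
Proof.
case/and3P => /eqP-> _ h; rewrite jordan_expr // leq_addr addKn.
by rewrite prednK ?dphi_gt0 // h.
Qed.

(** Three cases: the entry is identically zero, the eigenvalue has modulus below [r], or the modulus
    is [r] but the distance to the diagonal is below [s]. *)
Lemma noncritical_entry i j : ~~ critical i j ->
  to0 (fun k => mxe (Mpow k) i j / bpow s r%:C%C k).
Proof.
move=> ncr; have [/andP[ij h]|h] :=
  boolP ((i <= j)%N && jchain M (mxe M i i) i (j - i).+1); last first.
  apply: (to0_eq (@to0_const0 R)); exists 0%N => k _.
  by rewrite jordan_expr // (negPf h) mul0r.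
have [ir|ir] := eqVneq (cmod (mxe M i i)) r; last first.
  have ir' : cmod (mxe M i i) < r by rewrite lt_neqAle ir cmod_diag_le.
  apply: (to0_eq (to0_bpow_lt s (j - i) ir')); exists 0%N => k _.
  by rewrite jordan_expr // ij h.
have iN : (i < n)%N by rewrite (leq_trans _ (jchain_leq h)) // addnS ltnS leq_addr.
have jid : ((j - i).+1 <= d)%N := jchain_le_dphi h iN ir.
have js : (j - i < s)%N.
  rewrite ltn_neqAle -ltnS prednK ?dphi_gt0 // jid andbT.
  apply: contra ncr => /eqP js; rewrite /critical ir eqxx -js subnKC // eqxx /=.
  by rewrite -[d]prednK ?dphi_gt0 // -js.
apply: (to0_eq (to0_bpow_radius ir r0 js)); exists 0%N => k _.
by rewrite jordan_expr // ij h.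
Qed.

Lemma cmod_bpow_radius k : (s <= k)%N -> 0 < cmod (bpow s r%:C%C k).
Proof.
move=> sk; rewrite cmod_bpow cmodR mulr_gt0 ?ltr0n ?bin_gt0 //.
by rewrite exprn_gt0 // normr_gt0 gt_eqF.
Qed.

(** A critical position exists since [d] is attained, and its entry has exactly this modulus. Each
    other entry is eventually no larger. *)
Lemma bnorm_lpow : exists K, forall k, (K <= k)%N ->
  bnorm b (lpow phi k) = cmod (bpow s r%:C%C k).
Proof.
have h (ij : 'I_n * 'I_n) : exists K, forall k, (K <= k)%N ->
    cmod (mxe (Mpow k) ij.1 ij.2) <= cmod (bpow s r%:C%C k).
  have [cr|/noncritical_entry/(_ _ ltr01)[K hK]] := boolP (critical ij.1 ij.2).
    exists 0%N => k _; rewrite critical_entry // !cmod_bpow.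
    by have /and3P[_ /eqP-> _] := cr; rewrite cmodR gtr0_norm.
  exists (maxn s K) => k; rewrite geq_max => /andP[/cmod_bpow_radius c0 /hK].
  rewrite ComplexField.Normc.normcM ComplexField.Normc.normcV.
  by rewrite ltr_pdivrMr // mul1r => /ltW.
have [F hF] := fin_all_exists h.
exists (\max_ij F ij) => k FK; apply/eqP; rewrite eq_le; apply/andP; split.
  apply: bnorm_le => [|i j]; first exact: cmod_ge0.
  rewrite matof_lpow // -mxeE; apply: (hF (i, j)).
  by apply: leq_trans FK; exact: leq_bigmax.
have [i ir] := top_diag; have [|_ [z [l [zr h']]]] := dphi_attained (M := M) (r := r) (ltn_ord i).
  by rewrite mxeE.
have lsn : (l + s < n)%N.
  by rewrite -addnS prednK ?dphi_gt0 // (jchain_leq h').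
have ln : (l < n)%N by rewrite (leq_ltn_trans _ lsn) // leq_addr.
have lz : mxe M l l = z by case/jchainP: h'.
have cr : critical l (l + s) by rewrite /critical eqxx lz zr eqxx h'.
apply: le_trans (cmod_le_bnorm b _ (Ordinal ln) (Ordinal lsn)).
rewrite matof_lpow // -mxeE critical_entry // lz !cmod_bpow zr cmodR.
by rewrite gtr0_norm.
Qed.

Lemma bnorm_lpow_gt0 k : 0 < bnorm b (lpow phi k).
Proof.
have [i ir] := top_diag; apply: lt_le_trans (cmod_le_bnorm b _ i i).
rewrite matof_lpow // -mxeE jordan_expr // leqnn subnn jchain1 ltn_ord /=.
by rewrite cmod_bpow bin0 mul1r subn0 mxeE ir exprn_gt0.
Qed.

Definition limit_mx : 'M[C]_n :=
  \matrix_(i, j) ((j == i + s :> nat)%N && jchain M r%:C%C i d)%:R.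

Lemma mxe_limit_mx i j :
  mxe limit_mx i j = ((j == i + s)%N && jchain M r%:C%C i d)%:R.
Proof.
have [ni|iN] := leqP n i.
  rewrite mxe_out1 //; case: (boolP (jchain _ _ _ _)); rewrite ?andbF // => /jchain_leq.
  by rewrite leqNgt -(prednK dphi_gt0) addnS ltnS (leq_trans ni) ?leq_addr.
have [nj|jN] := leqP n j; last by rewrite (mxeE _ (Ordinal iN) (Ordinal jN)) mxE.
rewrite mxe_out2 //; case: eqP => //= ji.
case: (boolP (jchain _ _ _ _)) => // /jchain_leq.
by rewrite leqNgt -(prednK dphi_gt0) addnS ltnS -ji nj.
Qed.

(** At a critical position with eigenvalue [z] the normalised entry is eventually
    [(z / r) ^ (k - s)]. Its mean tends to 1 if [z = r] and to 0 otherwise; noncritical entries tend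
    to 0 already. *)
Lemma cesaro_to0 (i j : 'I_n) :
  to0 (fun N => matof b (cesaro phi b N) i j - limit_mx i j).
Proof.
have [K hK] := bnorm_lpow.
pose e k := ((bnorm b (lpow phi k))^-1)%:C%C * mxe (Mpow k) i j.
have eE k : (K <= k)%N -> e k = (cmod (bpow s r%:C%C k))^-1%:C%C * mxe (Mpow k) i j.
  by move=> /hK; rewrite /e => ->.
have bE k : (cmod (bpow s r%:C%C k))%:C%C = bpow s r%:C%C k.
  rewrite cmod_bpow cmodR gtr0_norm // rmorphM rmorphXn /= /bpow.
  by rewrite rmorph_nat.
have {}eE k : (K <= k)%N -> e k = mxe (Mpow k) i j / bpow s r%:C%C k.
  by move=> /eE->; rewrite fmorphV /= bE mulrC.
suff h : to0 (fun N => N%:R^-1 * (\sum_(1 <= k < N.+1) e k) - limit_mx i j).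
  by apply: (to0_eq h); exists 0%N => N _; rewrite matof_cesaro.
rewrite -mxeE mxe_limit_mx.
have [cr|ncr] := boolP (critical i j); last first.
  rewrite (_ : _ && _ = false).
    apply: to0_cesaro_lim; apply: (to0_eq (noncritical_entry ncr)).
    by exists K => k /eE->; rewrite subr0.
  apply: contraNF ncr => /andP[ji h]; rewrite /critical ji.
  by have [_ -> _] := jchainP _ _ _ _ h; rewrite h cmodR gtr0_norm ?eqxx.
have /and3P[ji /eqP zr h] := cr; set z := mxe M i i in zr h *.
have r0' : r%:C%C != 0 :> C by rewrite (inj_eq (@complexI R)) gt_eqF.
pose w := z / r%:C%C; have wE k : (maxn K s <= k)%N -> e k = w ^+ (k - s).
  rewrite geq_max => /andP[/eE-> sk]; rewrite critical_entry // /bpow -mulf_div.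
  by rewrite mulfV ?mul1r ?expr_div_n // pnatr_eq0 -lt0n bin_gt0.
rewrite ji /=; have [zE|zr'] := eqVneq z r%:C%C.
  rewrite -zE h; apply: to0_cesaro_lim; apply: (to0_eq (@to0_const0 R)).
  by exists (maxn K s) => k /wE->; rewrite /w zE mulfV // expr1n subrr.
rewrite (_ : jchain _ _ _ _ = false); last first.
  by apply/negP => /jchainP[_ zE _]; rewrite -zE eqxx in zr'.
have w1 : w != 1 by apply: contra zr' => /eqP w1; rewrite -[z](divfK r0') -/w w1 mul1r.
have cw : cmod w = 1.
  rewrite ComplexField.Normc.normcM ComplexField.Normc.normcV zr cmodR gtr0_norm //.
  by rewrite mulfV // gt_eqF.
have w0 : w != 0.
  by apply/eqP => w0; move/eqP: cw; rewrite w0 ComplexField.Normc.normc0 eq_sym oner_eq0.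
(* The sequence [e] agrees with the geometric one only from an index on; the difference is null, and
   so are its means. *)
have h1 : to0 (fun k => e k - w ^- s * w ^+ k - 0).
  apply: (to0_eq (@to0_const0 R)); exists (maxn K s) => k /[dup] /wE->.
  rewrite geq_max => /andP[_ sk]; rewrite subr0 -{2}(subnK sk) exprD mulrCA.
  by rewrite mulVf ?mulr1 ?subrr // expf_neq0.
apply: (to0_eq (to0D (to0_cesaro_lim h1) (to0Z (w ^- s) (to0_cesaro_expr cw w1)))).
exists 0%N => N _; rewrite !subr0 mulrCA -mulrDr; congr (_ * _).
by rewrite mulr_sumr -big_split /=; apply: eq_bigr => k _; rewrite subrK.
Qed.

Lemma maximal_partP psi : maximal_part phi b psi <-> matof b psi = limit_mx.
Proof.
rewrite maximal_part_to0; split=> [h|h i j]; last by rewrite h; exact: cesaro_to0.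
by apply/matrixP => i j; exact: to0_lim_unique (h i j) (cesaro_to0 i j).
Qed.

(** The superdiagonal contribution vanishes: a 1 at row [i] before a chain of length [d] from [i.+1]
    would give a chain of length [d.+1] for [r]. *)
Lemma limit_mx_mull : M *m limit_mx = r%:C%C *: limit_mx.
Proof.
apply/matrixP => i j; rewrite [RHS]mxE -!mxeE jordan_mul // !mxe_limit_mx.
rewrite [X in _ + X](_ : _ = 0) ?addr0.
  case: (boolP (jchain _ _ i _)) => [/jchainP[_ -> _] //|]; by rewrite andbF !mulr0.
have [->|[i1 ii]] := MJ.2 i; first by rewrite mul0r.
case: (boolP (jchain _ _ _ _)) => [h|]; last by rewrite andbF mulr0.
have iN : (i < n)%N by [].
have : (d.+1 <= d)%N; last by rewrite ltnn.
apply: (@jchain_le_dphi _ _ M r r%:C%C i) => //; last by rewrite cmodR gtr0_norm.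
have [_ ri _] := jchainP _ _ _ _ h.
by move: h; rewrite -(prednK dphi_gt0) => h; apply/jchain_consP; rewrite // ii ri.
Qed.

Lemma limit_mx_row X i j : mxe (limit_mx *m X) i j =
  if jchain M r%:C%C i d then mxe X (i + s) j else 0.
Proof.
rewrite mxe_mul; case: ifP => h; last first.
  by rewrite big1 // => l _; rewrite mxe_limit_mx h andbF mul0r.
rewrite (bigID (fun l : 'I_n => l == (i + s)%N :> nat)) /=.
rewrite [X in X + _](big_ord1_eq _ (fun l => mxe limit_mx i l * mxe X l j)).
rewrite -addnS (prednK dphi_gt0) (jchain_leq h) big1 ?addr0.
  by rewrite mxe_limit_mx eqxx h mul1r.
by move=> l /negPf ls; rewrite mxe_limit_mx ls mul0r.
Qed.

Lemma jchain_last z i m : jchain M z i m.+1 -> mxe M (i + m) (i + m) = z.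
Proof.
elim: m i => [|m IH] i; first by rewrite addn0; case/jchainP.
by move=> /(jchain_consP MJ)[_ _ /IH]; rewrite addSnnS.
Qed.

Lemma jchain_le z i m : cmod z = r -> (0 < m)%N -> jchain M z i m -> (m <= d)%N.
Proof.
move=> zr m0 h; apply: (jchain_le_dphi h _ zr); apply: leq_trans (jchain_leq h).
by rewrite -addn1 leq_add2l.
Qed.

Lemma limit_mx_mulr : limit_mx *m M = r%:C%C *: limit_mx.
Proof.
have cr : cmod (r%:C%C : C) = r by rewrite cmodR gtr0_norm.
apply/matrixP => i j; rewrite [RHS]mxE -!mxeE limit_mx_row mxe_limit_mx.
case: ifP => h; last by rewrite andbF mulr0.
have ends : mxe M (i + s) (i + s) = r%:C%C.
  by apply: jchain_last; rewrite prednK // dphi_gt0.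
rewrite andbT; have [->|ji] := eqVneq (val j) (i + s)%N; first by rewrite ends mulr1.
(* The only other possible entry is a superdiagonal 1 just after the corner, which would prolong the
   chain to length [s + 2], that is [d.+1]. *)
rewrite mulr0; have [jS|jS] := eqVneq (val j) (i + s).+1; last first.
  by rewrite MJ.1 //; exact/eqP.
rewrite jS; have [//|[h1 h2]] := MJ.2 (i + s)%N.
have jn : ((i + s).+1 < n)%N by rewrite -jS ltn_ord.
have : (s + 2 <= d)%N; last by rewrite addn2 -(prednK dphi_gt0) ltnn.
apply: (jchain_le (i := i) cr); first by rewrite addn2.
apply: (jchain_cat MJ (w := mxe M (i + s) (i + s))); first by rewrite prednK ?dphi_gt0.
by apply/(jchain_consP MJ); split => //; rewrite h2 jchain1.
Qed.

Lemma limit_mx_idem : d = 1%N -> limit_mx *m limit_mx = limit_mx.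
Proof.
move=> d1; apply/matrixP => i j; rewrite -!mxeE limit_mx_row mxe_limit_mx.
rewrite mxe_limit_mx d1 /= !addn0.
by case: ifP => h; rewrite ?h ?andbF.
Qed.

(** A nonzero entry would need chains of length [d] at both [i] and [i + s]. Glued together they
    have length [s + d], which exceeds [d] once [s > 0]. *)
Lemma limit_mx_nilp : (1 < d)%N -> limit_mx *m limit_mx = 0.
Proof.
move=> d1; have cr : cmod (r%:C%C : C) = r by rewrite cmodR gtr0_norm.
apply/matrixP => i j; rewrite -mxeE limit_mx_row mxe_limit_mx !mxE.
case: ifP => // h; case: (boolP (jchain _ _ (i + s) _)) => [h2|]; last by rewrite andbF.
have : (s + d <= d)%N.
  apply: (jchain_le (i := i) cr); first by rewrite addn_gt0 dphi_gt0 orbT.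
  by apply: (jchain_cat MJ _ h2); rewrite prednK ?dphi_gt0.
by rewrite leqNgt -[ltnLHS]add0n ltn_add2r -subn1 subn_gt0 d1.
Qed.

(** For [d = 1] the limit matrix is diagonal, with 1 exactly where the diagonal of the Jordan matrix
    is [r]. The coordinates of [x] elsewhere vanish. *)
Lemma limit_mx_fixed psi x : d = 1%N -> matof b psi = limit_mx ->
  phi x = r%:C%C *: x -> psi x = x.
Proof.
move=> d1 pE xr; rewrite [RHS](coord_basis bb (memvf x)) (coord_basis bb (memvf (psi x))).
apply: eq_bigr => i _; congr (_ *: _); rewrite coord_matof // pE.
have [Mi|Mi] := eqVneq (M i i) r%:C%C; last first.
  rewrite (coord_eigenvector_eq0 xr Mi) big1 // => j _; rewrite mxE.
  case: (boolP (jchain _ _ _ _)) => [/jchainP[_]|]; last by rewrite andbF mul0r.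
  by rewrite mxeE => Mi'; rewrite Mi' eqxx in Mi.
rewrite (bigD1 i) //= big1 ?addr0 => [|j ji].
  by rewrite mxE d1 addn0 eqxx -Mi -mxeE jchain1 ltn_ord mul1r.
by rewrite mxE d1 addn0 (inj_eq (@ord_inj _)) (negPf ji) mul0r.
Qed.

End JordanMap.

(** * Positivity of the maximal part *)

Section PositiveLimit.
Variables (R : realType) (A : falgType R[i]) (S : cstar_alg A).
Local Notation C := R[i].
Local Notation n := (\dim {:A}).
Local Notation star := (cstar S).
Variables (phi : 'End(A)) (b : n.-tuple A).
Hypotheses (pos : positive_map S phi) (bb : basis_of fullv b).

Lemma lpow_pos k : positive_map S (lpow phi k).
Proof.
elim: k => [|k IH] x xp /=; first by rewrite id_lfunE.
by rewrite comp_lfunE; apply/pos/IH.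
Qed.

Lemma tau_cesaro (u v x : A) N : tau (u * cesaro phi b N x * v) =
  N%:R^-1 * \sum_(1 <= k < N.+1)
    ((bnorm b (lpow phi k))^-1)%:C%C * tau (u * lpow phi k x * v).
Proof.
rewrite /cesaro lfunE /= -scalerAr -scalerAl tauZ sum_lfunE [u * _]mulr_sumr mulr_suml.
rewrite linear_sum; congr (_ * _); apply: eq_bigr => k _ /=.
by rewrite lfunE /= -scalerAr -scalerAl tauZ.
Qed.

Lemma tau_maximal_part psi (u v x : A) : maximal_part phi b psi ->
  to0 (fun N => tau (u * cesaro phi b N x * v) - tau (u * psi x * v)).
Proof.
move=> /maximal_part_to0 h.
apply: (to0_eq (to0_sum (index_enum 'I_n) (fun i =>
  to0Z (tau (u * b`_i * v)) (to0_sum (index_enum 'I_n) (fun j =>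
    to0Z (coord b j x) (h i j)))))).
exists 0%N => N _; have tau_expand (f : 'End(A)) : tau (u * f x * v) =
    \sum_(i < n) tau (u * b`_i * v) * \sum_(j < n) coord b j x * matof b f i j.
  rewrite (coord_basis bb (memvf (f x))) mulr_sumr mulr_suml linear_sum /=.
  apply: eq_bigr => i _; rewrite -scalerAr -scalerAl tauZ mulrC coord_matof //.
  by congr (_ * _); apply: eq_bigr => j _; rewrite mulrC.
rewrite !tau_expand -sumrB; apply: eq_bigr => i _.
by rewrite -mulrBr -sumrB; congr (_ * _); apply: eq_bigr => j _; rewrite mulrBr.
Qed.

Lemma maximal_part_pos psi : maximal_part phi b psi -> positive_map S psi.
Proof.
move=> h x xp; apply/is_posP => v; apply: to0_lim_ge0 (tau_maximal_part _ v x h) _.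
move=> N _; rewrite tau_cesaro mulr_ge0 ?invr_ge0 ?ler0n // sumr_ge0 // => k _.
rewrite mulr_ge0 ?(is_pos_tau v (lpow_pos k xp)) // (lecR 0) invr_ge0.
by rewrite /bnorm; elim/big_rec: _ => // i y _ y0; rewrite le_max y0 orbT.
Qed.

(** Each entry is a trace [tau (w * f y)] by [coord_tau], so [positive_map_bound] applies. The sum
    of the constants dominates each of them. *)
Lemma bnorm_bound : exists2 K : C, 0 <= K &
  forall f : 'End(A), positive_map S f -> (bnorm b f)%:C%C <= K * tau (f 1).
Proof.
have h (ij : 'I_n * 'I_n) : exists K : C, 0 <= K /\
    forall f : 'End(A), positive_map S f ->
      `|matof b f ij.1 ij.2| <= K * tau (f 1).
  have [w wE] := coord_tau S ij.1 bb.
  have [K K0 hK] := positive_map_bound S w b`_(ij.2).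
  by exists K; split=> // f fp; rewrite matofE // wE hK.
have [F hF] := fin_all_exists h.
exists (\sum_ij F ij) => [|f fp]; first by rewrite sumr_ge0 // => ij _; case: (hF ij).
have t0 : 0 <= tau (f 1).
  by apply: (tau_ge0 (S := S)); apply: fp; exists 1; rewrite star1 mulr1.
have B0 : 0 <= (\sum_ij F ij) * tau (f 1).
  by rewrite mulr_ge0 // sumr_ge0 // => ij _; case: (hF ij).
rewrite /bnorm; elim/big_ind: _ => // [x y hx hy|i _]; first by rewrite maxEle; case: ifP.
elim/big_ind: _ => // [x y hx hy|j _]; first by rewrite maxEle; case: ifP.
rewrite cmodE; apply: le_trans ((hF (i, j)).2 _ fp) _; apply: ler_wpM2r => //.
by rewrite (bigD1 (i, j)) //= lerDl sumr_ge0 // => ij _; case: (hF ij).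
Qed.

(* Positive maps attain their size at [1], so the normalised powers stay away from [0] there. *)
Lemma maximal_part1_neq0 psi : (forall k, 0 < bnorm b (lpow phi k)) ->
  maximal_part phi b psi -> psi 1 != 0.
Proof.
move=> b0 h; have [K K0 hK] := bnorm_bound.
have lim : to0 (fun N => (K * tau (1 * cesaro phi b N 1 * 1) - 1) -
                         (K * tau (1 * psi 1 * 1) - 1)).
  apply: (to0_eq (to0Z K (tau_maximal_part 1 1 1 h))); exists 0%N => N _.
  by rewrite mulrBr opprB addrA subrK.
(* Each normalised power satisfies [K * tau (_ 1) >= 1] by [bnorm_bound]; the inequality passes to
   the means and to the limit. *)
have : 0 <= K * tau (1 * psi 1 * 1) - 1.
  apply: to0_lim_ge0 lim _ => N N0; rewrite subr_ge0 tau_cesaro mulrCA.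
  rewrite mulrC ler_pdivlMr ?ltr0n // mul1r mulr_sumr.
  have -> : N%:R = \sum_(1 <= k < N.+1) (1 : C) by rewrite sumr_const_nat subn1.
  apply: ler_sum => k _; rewrite mul1r mulr1 mulrCA fmorphV /= mulrC.
  by rewrite ler_pdivlMr ?(ltcR 0) // mul1r; apply/hK/lpow_pos.
apply: contraTneq => ->; rewrite mulr0 mul0r linear0 mulr0 sub0r.
by rewrite oppr_ge0 ler10.
Qed.

End PositiveLimit.

(** * The four properties of the maximal part *)

Unset Implicit Arguments.

Theorem theorem4p10 (R : realType) (A : falgType R[i]) (S : cstar_alg A)
    (phi : 'End(A)) (r : R) (b : (\dim {:A}).-tuple A) :
  positive_map S phi -> spectral_radius phi r -> 0 < r ->
  jordan_basis phi b ->
  (exists psi : 'End(A), maximal_part phi b psi) /\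
  (forall psi : 'End(A), maximal_part phi b psi ->
     (psi != 0 /\ positive_map S psi) /\
     [/\ (* (1) *)
      (phi \o psi)%VF = r%:C%C *: psi /\ (psi \o phi)%VF = r%:C%C *: psi,
      (* (2) *)
      [/\ is_pos S (psi 1), psi 1 != 0 & phi (psi 1) = r%:C%C *: psi 1],
      (* (3) *)
      ((psi \o psi)%VF = psi <-> dphi (matof b phi) r = 1%N) /\
      ((psi \o psi)%VF = 0 <-> (1 < dphi (matof b phi) r)%N) &
      (* (4) *)
      (psi \o psi)%VF = psi ->
        forall x : A, phi x = r%:C%C *: x <-> psi x = x]).
Proof.
move=> pos sr r0 jb; have bb := jb.1; split.
  have [psi psiE] := matof_surj bb (limit_mx phi r b).
  by exists psi; apply/(maximal_partP sr r0 jb).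
move=> psi h; have psiE := (maximal_partP sr r0 jb psi).1 h.
have psi1 := maximal_part1_neq0 pos bb (bnorm_lpow_gt0 sr r0 jb) h.
have psi0 : psi != 0 by apply: contraNneq psi1 => ->; rewrite zero_lfunE.
have psi_pos := maximal_part_pos pos bb h.
have mull : (phi \o psi)%VF = r%:C%C *: psi.
  by apply: (matof_inj bb); rewrite matof_comp // matof_scale // psiE limit_mx_mull.
have mulr : (psi \o phi)%VF = r%:C%C *: psi.
  by apply: (matof_inj bb); rewrite matof_comp // matof_scale // psiE limit_mx_mulr.
have idem : dphi (matof b phi) r = 1%N -> (psi \o psi)%VF = psi.
  by move=> d1; apply: (matof_inj bb); rewrite matof_comp // psiE limit_mx_idem.
have nilp : (1 < dphi (matof b phi) r)%N -> (psi \o psi)%VF = 0.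
  move=> d1; apply: (matof_inj bb); rewrite matof_comp // psiE limit_mx_nilp //.
  by apply/matrixP => i j; rewrite [LHS]mxE matofE // zero_lfunE linear0.
have d0 := dphi_gt0 sr jb.
(* Since [d >= 1], one of [idem] and [nilp] always applies. As [psi != 0], their conclusions exclude
   each other, which yields both converses. *)
have idemP : (psi \o psi)%VF = psi -> dphi (matof b phi) r = 1%N.
  move=> pp; apply/eqP; rewrite eqn_leq d0 andbT leqNgt; apply/negP => /nilp.
  by rewrite pp => /eqP; rewrite (negPf psi0).
split; first by [].
split => //.
- split => //; first by apply: psi_pos; exists 1; rewrite star1 mulr1.
  by rewrite -comp_lfunE mull lfunE.
- split; split => // pp; rewrite ltn_neqAle d0 andbT eq_sym; apply/eqP => /idem.
  by rewrite pp => /eqP; rewrite eq_sym (negPf psi0).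
(* Conversely, [psi x = x] gives [phi x = phi (psi x) = r psi x = r x]. *)
- move=> /idemP d1 x; split=> [|xE]; first exact: (limit_mx_fixed jb d1 psiE).
  by rewrite -{1}xE -comp_lfunE mull lfunE /= xE.
Qed.
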